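(* Let $\Bbbk$ be a field of characteristic zero, $(\mathfrak g,r)$ a finite dimensional quasitriangular Lie bialgebra over $\Bbbk$, and $(U_\hbar(\mathfrak g),R)$ a quasitriangular quantised universal enveloping algebra quantising $(\mathfrak g,r)$. Let $\mathfrak R$ be the braiding of $F[[\mathfrak g^*]]$ obtained from $\mathrm{Ad}(R)|_{U_\hbar(\mathfrak g)'\otimes U_\hbar(\mathfrak g)'}$ by specialisation at $\hbar=0$, and let $\overline{\mathfrak R}:\mathfrak g\oplus\mathfrak g\to\mathfrak g\oplus\mathfrak g$ be the associated infinitesimal braiding. Then $\overline{\mathfrak R}$ is trivial, i.e. $\overline{\mathfrak R}=\mathrm{id}_{\mathfrak g\oplus\mathfrak g}$.
   Context: **Quasitriangular Lie bialgebra.** A Lie bialgebra $(\mathfrak g,\delta)$ with $r\in\mathfrak g\otimes\mathfrak g$ satisfying the classical Yang–Baxter equation, with $r+r_{21}$ $\mathfrak g$-invariant and $\delta(x)=[x\otimes1+1\otimes x,r]$. $\mathfrak g^*$ is the dual Lie bialgebra. $F[[\mathfrak g^*]]$ is the topological Poisson Hopf algebra of functions on the formal Poisson group with tangent Lie bialgebra $\mathfrak g^*$. **Quantisation.** $U_\hbar(\mathfrak g)$ is a topologically free $\Bbbk[[\hbar]]$-Hopf algebra (tensor products $\hbar$-adically completed) with $U_\hbar(\mathfrak g)/\hbar U_\hbar(\mathfrak g)\cong U(\mathfrak g)$ as co-Poisson Hopf algebras, the co-Poisson structure on the quotient being $\hbar^{-1}(\Delta-\Delta^{op})\bmod\hbar$.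 The invertible element $R\in U_\hbar(\mathfrak g)\otimes U_\hbar(\mathfrak g)$ satisfies $R\Delta(a)R^{-1}=\Delta^{op}(a)$, $(\Delta\otimes\mathrm{id})(R)=R_{13}R_{23}$ and $(\mathrm{id}\otimes\Delta)(R)=R_{13}R_{12}$. Under an identification $U_\hbar(\mathfrak g)\cong U(\mathfrak g)[[\hbar]]$ of $\Bbbk[[\hbar]]$-modules, $R=1+\hbar r+O(\hbar^2)$. Here $\mathrm{Ad}(R)(x)=RxR^{-1}$. **The subalgebra $U_\hbar(\mathfrak g)'$.** For a Hopf algebra $H$ over $\Bbbk[[\hbar]]$ with iterated coproducts $\Delta^n:H\to H^{\otimes n}$ ($\Delta^0=\epsilon$, $\Delta^1=\mathrm{id}$), set $\delta_n=(\mathrm{id}-\epsilon)^{\otimes n}\circ\Delta^n$ and $H'=\{a\in H\mid\delta_n(a)\in\hbar^nH^{\otimes n}\ \forall n\ge0\}$. Known facts (quantum duality principle). $U_\hbar(\mathfrak g)'$ is a topological Hopf algebra, and $U_\hbar(\mathfrak g)'/\hbar\,U_\hbar(\mathfrak g)'\cong F[[\mathfrak g^*]]$ as topological Poisson Hopf algebras, with Poisson bracket $\hbar^{-1}[\ ,\ ]\bmod\hbar$. Explicitly, any basis of $\mathfrak g$ has a lift $x_1,\dots,x_d\in U_\hbar(\mathfrak g)$ with $\epsilon(x_i)=0$ such that $U_\hbar(\mathfrak g)'=\{\sum_{e\in\mathbb N^d}a_e\hbar^{|e|}x^e\mid a_e\in\Bbbk[[\hbar]]\}$, where $x^e=x_1^{e_1}\cdots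 x_d^{e_d}$ and $|e|=\sum_i e_i$. Moreover $(U_\hbar(\mathfrak g)\otimes U_\hbar(\mathfrak g))'=U_\hbar(\mathfrak g)'\otimes U_\hbar(\mathfrak g)'$ (suitably completed tensor product), and its reduction modulo $\hbar$ is $F[[\mathfrak g^*]]\otimes F[[\mathfrak g^*]]=F[[\mathfrak g^*\oplus\mathfrak g^*]]$. Known fact (earlier theorem). $\mathrm{Ad}(R)$ restricts to an automorphism of $U_\hbar(\mathfrak g)'\otimes U_\hbar(\mathfrak g)'$. Hence by reduction modulo $\hbar$ it induces a Poisson algebra automorphism $\mathfrak R$ of $F[[\mathfrak g^*\oplus\mathfrak g^*]]$, which is a braiding. **Infinitesimal braiding.** Let $\mathfrak m$ be the maximal ideal of $F[[\mathfrak g^*\oplus\mathfrak g^*]]$. An algebra automorphism $\mathfrak R$ preserves $\mathfrak m$, hence induces an automorphism $\overline{\mathfrak R}$ of $\mathfrak m/\mathfrak m^2$. This space, with the Lie bracket induced by the Poisson bracket, is canonically $\mathfrak g\oplus\mathfrak g$. *)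

(* Defs.v *)
(* Mathematical Components, with the free modules {malg k[B]} of multinomials
   (monalg) and classical choice (boolp). *)
From HB Require Import structures.
From mathcomp Require Import all_boot all_order all_algebra.
From mathcomp Require Import boolp.
From mathcomp Require Import finmap.
From mathcomp Require Import monalg.

Set Implicit Arguments.
Unset Strict Implicit.
Unset Printing Implicit Defensive.

Import GRing.Theory.
Local Open Scope ring_scope.

(* the ring k[[h]]; a power series is its sequence of coefficients *)
Definition fps (k : fieldType) : Type := nat -> k.

HB.instance Definition _ (k : fieldType) := Choice.copy (fps k) (nat -> k).

Section Fps.
Variable k : fieldType.
Implicit Types a b c : fps k.

Lemma fpsP a b : (forall n, a n = b n) -> a = b.
Proof. exact: functional_extensionality_dep. Qed.

Definition fps_zero : fps k := fun=> 0.
Definition fps_opp a : fps k := fun n => - a n.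
Definition fps_add a b : fps k := fun n => a n + b n.
Definition fps_one : fps k := fun n => (n == 0%N)%:R.
Definition fps_mul a b : fps k := fun n => \sum_(i < n.+1) a i * b (n - i)%N.

Fact fps_addA : associative fps_add.
Proof. by move=> a b c; apply: fpsP => n; exact: addrA. Qed.
Fact fps_addC : commutative fps_add.
Proof. by move=> a b; apply: fpsP => n; exact: addrC. Qed.
Fact fps_add0 : left_id fps_zero fps_add.
Proof. by move=> a; apply: fpsP => n; exact: add0r. Qed.
Fact fps_addN : left_inverse fps_zero fps_opp fps_add.
Proof. by move=> a; apply: fpsP => n; exact: addNr. Qed.

HB.instance Definition _ :=
  GRing.isZmodule.Build (fps k) fps_addA fps_addC fps_add0 fps_addN.

Let trunc n a : {poly k} := \poly_(i < n) a i.

Let coef_trunc n a i : (i < n)%N -> (trunc n a)`_i = a i.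
Proof. by move=> lt_in; rewrite coef_poly lt_in. Qed.

Let coef_truncM n a b i :
  (i < n)%N -> (trunc n a * trunc n b)`_i = fps_mul a b i.
Proof.
move=> lt_in; rewrite coefM; apply: eq_bigr => -[j /= lt_ji] _.
rewrite !coef_trunc //; first exact: leq_ltn_trans (leq_subr _ _) lt_in.
by apply: leq_ltn_trans lt_in.
Qed.

Fact fps_mulC : commutative fps_mul.
Proof.
move=> a b; apply: fpsP => n.
by rewrite -!(@coef_truncM n.+1) // mulrC.
Qed.

Fact fps_mulA : associative fps_mul.
Proof.
move=> a b c; apply: fpsP => n.
transitivity (trunc n.+1 a * (trunc n.+1 b * trunc n.+1 c))`_n.
  rewrite coefM; apply: eq_bigr => -[j /= lt_j] _.
  by rewrite coef_trunc // coef_truncM // ltnS leq_subr.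
rewrite mulrA coefM; apply: eq_bigr => -[j /= lt_j] _.
by rewrite coef_truncM // coef_trunc // ltnS leq_subr.
Qed.

Fact fps_mul1 : left_id fps_one fps_mul.
Proof.
move=> a; apply: fpsP => n.
rewrite /fps_mul big_ord_recl /= mul1r subn0 big1 ?addr0 // => i _.
by rewrite /fps_one /= mul0r.
Qed.

Fact fps_mulDl : left_distributive fps_mul fps_add.
Proof.
move=> a b c; apply: fpsP => n; rewrite /fps_add /fps_mul -big_split.
by apply: eq_bigr => i _; rewrite mulrDl.
Qed.

Fact fps_one_neq0 : fps_one != fps_zero.
Proof.
by apply/eqP => /(congr1 (fun a : fps k => a 0%N)) /eqP; rewrite oner_eq0.
Qed.

HB.instance Definition _ := GRing.Zmodule_isComNzRing.Build (fps k)
  fps_mulA fps_mulC fps_mul1 fps_mulDl fps_one_neq0.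

Definition hbar : fps k := fun n => (n == 1%N)%:R.

End Fps.

Arguments hbar {k}.

(* A k-vector space is given with a basis [B], as {malg k[B]} (finitely
   supported functions B -> k); the tensor product of the spaces with bases B
   and C is the space with basis B * C.  A topologically free k[[h]]-module is
   V[[h]] for such a V: [hvec k B].  The h-adically completed tensor product of
   V[[h]] and W[[h]] is (V (x) W)[[h]], that is [hvec k (B * C)], and k[[h]] is
   [hvec k unit]. *)

Definition hvec (k : fieldType) (B : choiceType) : Type := nat -> {malg k[B]}.

HB.instance Definition _ (k : fieldType) (B : choiceType) :=
  Choice.copy (hvec k B) (nat -> {malg k[B]}).

Arguments hvec k B%_type.

Section HvecModule.
Variables (k : fieldType) (B : choiceType).
Implicit Types (a b : fps k) (f g : hvec k B).

Lemma hvecP f g : (forall n, f n = g n) -> f = g.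
Proof. exact: functional_extensionality_dep. Qed.

Definition hvec_zero : hvec k B := fun=> 0.
Definition hvec_opp f : hvec k B := fun n => - f n.
Definition hvec_add f g : hvec k B := fun n => f n + g n.
Definition hvec_scale a f : hvec k B :=
  fun n => \sum_(i < n.+1) a i *: f (n - i)%N.

Fact hvec_addA : associative hvec_add.
Proof. by move=> a b c; apply: hvecP => n; exact: addrA. Qed.
Fact hvec_addC : commutative hvec_add.
Proof. by move=> a b; apply: hvecP => n; exact: addrC. Qed.
Fact hvec_add0 : left_id hvec_zero hvec_add.
Proof. by move=> a; apply: hvecP => n; exact: add0r. Qed.
Fact hvec_addN : left_inverse hvec_zero hvec_opp hvec_add.
Proof. by move=> a; apply: hvecP => n; exact: addNr. Qed.

HB.instance Definition _ :=
  GRing.isZmodule.Build (hvec k B) hvec_addA hvec_addC hvec_add0 hvec_addN.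

Let coord x f : fps k := fun n => (f n)@_x.

Let coordP f g : (forall x, coord x f = coord x g) -> f = g.
Proof.
move=> fg; apply: hvecP => n; apply/malgP => x.
exact: (congr1 (fun a : fps k => a n) (fg x)).
Qed.

Let coordD x f g : coord x (f + g) = coord x f + coord x g.
Proof. by apply: fpsP => n; exact: mcoeffD. Qed.

Let coordZ x a f : coord x (hvec_scale a f) = a * coord x f.
Proof.
apply: fpsP => n; rewrite /coord /hvec_scale raddf_sum.
by apply: eq_bigr => i _; exact: mcoeffZ.
Qed.

Fact hvec_scaleA a b f : hvec_scale a (hvec_scale b f) = hvec_scale (a * b) f.
Proof. by apply: coordP => x; rewrite !coordZ mulrA. Qed.
Fact hvec_scale1 : left_id 1 hvec_scale.
Proof. by move=> f; apply: coordP => x; rewrite coordZ mul1r. Qed.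
Fact hvec_scaleDr : right_distributive hvec_scale +%R.
Proof.
by move=> a f g; apply: coordP => x; rewrite !(coordZ, coordD) mulrDr.
Qed.
Fact hvec_scaleDl f : {morph hvec_scale^~ f : a b / a + b}.
Proof.
by move=> a b; apply: coordP => x; rewrite !(coordZ, coordD) mulrDl.
Qed.

HB.instance Definition _ := GRing.Zmodule_isLmodule.Build (fps k) (hvec k B)
  hvec_scaleA hvec_scale1 hvec_scaleDr hvec_scaleDl.

Definition modh f : {malg k[B]} := f 0%N.

Definition hbasis (b : B) : hvec k B := fun n => if n == 0%N then << b >> else 0.

(* f belongs to h^n V[[h]] *)
Definition hdvd (n : nat) f := exists g, f = hbar ^+ n *: g.

End HvecModule.

Arguments hbasis k {B} b.

Section Tensor.
Variable k : fieldType.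

Definition kten (B C : choiceType) (u : {malg k[B]}) (v : {malg k[C]}) :
    {malg k[(B * C)%type]} :=
  \sum_(b <- msupp u) \sum_(c <- msupp v) << u@_b * v@_c *g (b, c) >>.

Definition hten (B C : choiceType) (f : hvec k B) (g : hvec k C) :
    hvec k (B * C) :=
  fun n => \sum_(i < n.+1) kten (f i) (g (n - i)%N).

(* The k[[h]]-linear (hence h-adically continuous) map sending the basis
   element b to phi b. *)
Definition hext (B C : choiceType) (phi : B -> hvec k C) (f : hvec k B) :
    hvec k C :=
  fun n => \sum_(i < n.+1) \sum_(b <- msupp (f i)) (f i)@_b *: phi b (n - i)%N.

(* the map induced by a map of bases: associativity, flips, etc *)
Definition relab (B C : choiceType) (s : B -> C) : hvec k B -> hvec k C :=
  hext (fun b => hbasis k (s b)).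

(* the completed tensor product of two k[[h]]-linear maps *)
Definition tmap (B B' C C' : choiceType)
    (F : hvec k B -> hvec k C) (G : hvec k B' -> hvec k C') :
    hvec k (B * B') -> hvec k (C * C') :=
  hext (fun p => hten (F (hbasis k p.1)) (G (hbasis k p.2))).

(* basis of the n-th tensor power *)
Fixpoint tpow (B : choiceType) (n : nat) : choiceType :=
  if n is n'.+1 then (B * tpow B n')%type else unit.

Fixpoint tmapn (B C : choiceType) (F : hvec k B -> hvec k C) (n : nat) :
    hvec k (tpow B n) -> hvec k (tpow C n) :=
  if n is n'.+1 return hvec k (tpow B n) -> hvec k (tpow C n)
  then tmap F (@tmapn B C F n') else id.

End Tensor.

Definition assocl (B C D : Type) (p : B * C * D) : B * (C * D) :=
  (p.1.1, (p.1.2, p.2)).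
Definition mid4 (A B C D : Type) (p : (A * B) * (C * D)) : (A * C) * (B * D) :=
  ((p.1.1, p.2.1), (p.1.2, p.2.2)).
Definition swap (B C : Type) (p : B * C) : C * B := (p.2, p.1).

Definition expo (d N : nat) (e : {ffun 'I_d -> 'I_N}) : {ffun 'I_d -> nat} :=
  [ffun i => nat_of_ord (e i)].
Definition deg (d : nat) (e : {ffun 'I_d -> nat}) : nat := (\sum_(i < d) e i)%N.

(* The structure maps are bare functions; [is_hopf] requires them to be
   k[[h]]-linear, which makes them h-adically continuous. *)
Record hopf_data (k : fieldType) (B : choiceType) := HopfData {
  hmul : hvec k (B * B) -> hvec k B;
  hunit : hvec k unit -> hvec k B;
  hcomul : hvec k B -> hvec k (B * B);
  hcounit : hvec k B -> hvec k unit;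
  hanti : hvec k B -> hvec k B }.

Arguments hopf_data k B%_type.

Definition tensor_hopf (k : fieldType) (B C : choiceType)
    (H : hopf_data k B) (K : hopf_data k C) : hopf_data k (B * C) := {|
  hmul := fun f => tmap (hmul H) (hmul K) (relab (@mid4 B C B C) f);
  hunit := fun f => tmap (hunit H) (hunit K) (relab (fun _ : unit => (tt, tt)) f);
  hcomul := fun f => relab (@mid4 B B C C) (tmap (hcomul H) (hcomul K) f);
  hcounit := fun f =>
    relab (fun _ : unit * unit => tt) (tmap (hcounit H) (hcounit K) f);
  hanti := tmap (hanti H) (hanti K) |}.

Section Hopf.
Variables (k : fieldType) (B : choiceType) (H : hopf_data k B).
Implicit Types a b : hvec k B.

Definition mulh a b : hvec k B := hmul H (hten a b).
Definition oneh : hvec k B := hunit H (hbasis k tt).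
Definition exph a n : hvec k B := iter n (mulh a) oneh.

Record is_hopf : Prop := IsHopf {
  hmul_linear : linear (hmul H);
  hunit_linear : linear (hunit H);
  hcomul_linear : linear (hcomul H);
  hcounit_linear : linear (hcounit H);
  hanti_linear : linear (hanti H);
  hmulA : forall t : hvec k (B * B * B),
    hmul H (tmap (hmul H) id t) = hmul H (tmap id (hmul H) (relab (@assocl B B B) t));
  hmul1l : forall a, mulh oneh a = a;
  hmul1r : forall a, mulh a oneh = a;
  hcomulA : forall a,
    relab (@assocl B B B) (tmap (hcomul H) id (hcomul H a)) =
    tmap id (hcomul H) (hcomul H a);
  hcounitl : forall a, relab snd (tmap (hcounit H) id (hcomul H a)) = a;
  hcounitr : forall a, relab fst (tmap id (hcounit H) (hcomul H a)) = a;
  hcomulM : forall t : hvec k (B * B), hcomul H (hmul H t) =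
    hmul (tensor_hopf H H) (tmap (hcomul H) (hcomul H) t);
  hcomul1 : hcomul H oneh = hten oneh oneh;
  hcounitM : forall t : hvec k (B * B), hcounit H (hmul H t) =
    relab (fun _ : unit * unit => tt) (tmap (hcounit H) (hcounit H) t);
  hcounit1 : hcounit H oneh = hbasis k tt;
  hantil : forall a,
    hmul H (tmap (hanti H) id (hcomul H a)) = hunit H (hcounit H a);
  hantir : forall a,
    hmul H (tmap id (hanti H) (hcomul H a)) = hunit H (hcounit H a) }.

(* iterated coproduct, with Delta^0 = epsilon; [tpow B 1] is B * unit, so
   Delta^1 is the identity up to the identification H (x) k[[h]] = H *)
Fixpoint hcomuln (n : nat) : hvec k B -> hvec k (tpow B n) :=
  if n is n'.+1 return hvec k B -> hvec k (tpow B n)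
  then fun a => tmap id (@hcomuln n') (hcomul H a) else hcounit H.

Definition deltan (n : nat) a : hvec k (tpow B n) :=
  tmapn (fun x => x - hunit H (hcounit H x)) (@hcomuln n a).

(* the subset H' of H *)
Definition primed a := forall n, hdvd n (@deltan n a).

(* x^e = x_1^{e_1} ... x_d^{e_d}, in this order *)
Definition monh (d : nat) (x : 'I_d -> hvec k B) (e : {ffun 'I_d -> nat}) :
    hvec k B :=
  \big[mulh/oneh]_(i < d) exph (x i) (e i).

(* a is a sum \sum_e c_e h^|e| x^e, convergent in the h-adic topology: modulo
   h^N only the exponents e with all e_i < N contribute *)
Definition hseries (d : nat) (x : 'I_d -> hvec k B) a :=
  exists c : {ffun 'I_d -> nat} -> fps k, forall N, hdvd N
    (a - \sum_(e : {ffun 'I_d -> 'I_N})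
           (c (expo e) * hbar ^+ deg (expo e)) *: monh x (expo e)).

(* the completed tensor square of the previous set: the elements
   \sum_{e,f} c_{e,f} h^{|e|+|f|} x^e (x) x^f *)
Definition hseries2 (d : nat) (x : 'I_d -> hvec k B) (t : hvec k (B * B)) :=
  exists c : {ffun 'I_d -> nat} -> {ffun 'I_d -> nat} -> fps k, forall N, hdvd N
    (t - \sum_(e : {ffun 'I_d -> 'I_N}) \sum_(f : {ffun 'I_d -> 'I_N})
           (c (expo e) (expo f) * hbar ^+ (deg (expo e) + deg (expo f))) *:
             hten (monh x (expo e)) (monh x (expo f))).

End Hopf.

(* The Lie algebra g is the vector space with basis indexed by 'I_d. *)
Section LieBialgebra.
Variables (k : fieldType) (d : nat).
Local Notation g := {malg k['I_d]}.
Local Notation gg := {malg k[('I_d * 'I_d)%type]}.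

Local Notation E i := (<< i >> : g) (only parsing).

Variables (br : g -> g -> g) (delta : g -> gg) (r : gg).

Record is_lie : Prop := IsLie {
  lie_linearl : forall y, linear (br^~ y);
  lie_linearr : forall x, linear (br x);
  lie_alt : forall x, br x x = 0;
  lie_jacobi : forall x y z, br x (br y z) + br y (br z x) + br z (br x y) = 0 }.

(* x.t = [x (x) 1 + 1 (x) x, t] *)
Definition ad2 (x : g) (t : gg) : gg :=
  \sum_(i < d) \sum_(j < d)
     t@_(i, j) *: (kten (br x (E i)) (E j) + kten (E i) (br x (E j))).

Definition cobr_id (t : gg) : {malg k[('I_d * 'I_d * 'I_d)%type]} :=
  \sum_(i < d) \sum_(j < d) t@_(i, j) *: kten (delta (E i)) (E j).

Record is_lie_bialgebra : Prop := IsLieBialgebra {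
  bialg_lie : is_lie;
  cobr_linear : linear delta;
  cobr_skew : forall x i j, (delta x)@_(i, j) = - (delta x)@_(j, i);
  cobr_cojacobi : forall x i j l,
    let t := cobr_id (delta x) in
    t@_(i, j, l) + t@_(j, l, i) + t@_(l, i, j) = 0;
  cobr_cocycle : forall x y,
    delta (br x y) = ad2 x (delta y) - ad2 y (delta x) }.

(* [r12, r13] + [r12, r23] + [r13, r23] *)
Definition cybe_lhs : {malg k[('I_d * ('I_d * 'I_d))%type]} :=
  \sum_(i < d) \sum_(j < d) \sum_(m < d) \sum_(l < d)
    (r@_(i, j) * r@_(m, l)) *:
      (kten (br (E i) (E m)) (kten (E j) (E l)) +
       kten (E i) (kten (br (E j) (E m)) (E l)) +
       kten (E i) (kten (E m) (br (E j) (E l)))).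

Definition sym_part : gg :=
  \sum_(i < d) \sum_(j < d) << r@_(i, j) + r@_(j, i) *g (i, j) >>.

Record is_quasitriangular_lie : Prop := IsQuasitriangularLie {
  qt_bialg : is_lie_bialgebra;
  qt_cybe : cybe_lhs = 0;
  qt_inv : forall x, ad2 x sym_part = 0;
  qt_cobr : forall x, delta x = ad2 x r }.

End LieBialgebra.

(* (U, iota) is the universal enveloping algebra of (g, br).  The injectivity of
   iota (a consequence of the universal property, by Poincare-Birkhoff-Witt)
   makes g a subspace of U(g). *)
Record is_enveloping (k : fieldType) (d : nat)
    (br : {malg k['I_d]} -> {malg k['I_d]} -> {malg k['I_d]})
    (U : algType k) (iota : {malg k['I_d]} -> U) : Prop := IsEnveloping {
  env_linear : linear iota;
  env_inj : injective iota;
  env_br : forall x y, iota (br x y) = iota x * iota y - iota y * iota x;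
  env_univ : forall (A : algType k) (f : {malg k['I_d]} -> A),
    linear f -> (forall x y, f (br x y) = f x * f y - f y * f x) ->
    exists phi : {lrmorphism U -> A}, forall x, phi (iota x) = f x;
  env_uniq : forall (A : algType k) (phi psi : {lrmorphism U -> A}),
    (forall x, phi (iota x) = psi (iota x)) -> phi =1 psi }.

Section Quantisation.
Variables (k : fieldType) (d : nat).
Local Notation g := {malg k['I_d]}.
Local Notation gg := {malg k[('I_d * 'I_d)%type]}.
Variables (br : g -> g -> g) (delta : g -> gg) (r : gg).
Variables (B : choiceType) (H : hopf_data k B).
Variables (U : algType k) (iota : g -> U) (theta : U -> {malg k[B]}).
Local Notation H2 := (tensor_hopf H H).
Local Notation H3 := (tensor_hopf H (tensor_hopf H H)).

(* theta (x) theta on the image of g (x) g *)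
Definition theta2 (t : gg) : {malg k[(B * B)%type]} :=
  \sum_(i < d) \sum_(j < d)
    t@_(i, j) *: kten (theta (iota << i >>)) (theta (iota << j >>)).

(* [theta] identifies U(g) with H / hH, whose underlying space is {malg k[B]},
   as co-Poisson Hopf algebras.  As U(g) is generated by g, it is enough to
   compare on g the coproducts (g is primitive in U(g)) and the Poisson
   cobrackets (that of U(g) extends delta by the co-Leibniz rule). *)
Record is_quantisation : Prop := IsQuantisation {
  quant_hopf : is_hopf H;
  quant_linear : linear theta;
  quant_bij : bijective theta;
  quant_one : modh (oneh H) = theta 1;
  quant_mul : forall (a b : hvec k B) (u v : U),
    modh a = theta u -> modh b = theta v -> modh (mulh H a b) = theta (u * v);
  quant_counit : forall (a : hvec k B) (x : g),
    modh a = theta (iota x) -> modh (hcounit H a) = 0;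
  quant_comul : forall (a : hvec k B) (x : g),
    modh a = theta (iota x) ->
    modh (hcomul H a) =
      kten (theta (iota x)) (theta 1) + kten (theta 1) (theta (iota x));
  quant_copoisson : forall (a : hvec k B) (x : g) (b : hvec k (B * B)),
    modh a = theta (iota x) ->
    hcomul H a - relab (@swap B B) (hcomul H a) = hbar *: b ->
    modh b = theta2 (delta x) }.

Section RMatrix.
Variables R Rinv : hvec k (B * B).

Definition R12 : hvec k (B * (B * B)) :=
  relab (@assocl B B B) (hten R (oneh H)).
Definition R23 : hvec k (B * (B * B)) := hten (oneh H) R.
Definition R13 : hvec k (B * (B * B)) :=
  relab (fun p : B * (B * B) => (p.1, (p.2.2, p.2.1))) R12.

Record is_rmatrix : Prop := IsRMatrix {
  rmat_invl : mulh H2 Rinv R = oneh H2;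
  rmat_invr : mulh H2 R Rinv = oneh H2;
  rmat_comul : forall a : hvec k B,
    mulh H2 (mulh H2 R (hcomul H a)) Rinv = relab (@swap B B) (hcomul H a);
  rmat_hexl : relab (@assocl B B B) (tmap (hcomul H) id R) = mulh H3 R13 R23;
  rmat_hexr : tmap id (hcomul H) R = mulh H3 R13 R12;
  (* R = 1 + h r + O(h^2) *)
  rmat_class : exists2 rho : hvec k (B * B),
    R = oneh H2 + hbar *: rho & modh rho = theta2 r }.

Definition AdR (t : hvec k (B * B)) : hvec k (B * B) :=
  mulh H2 (mulh H2 R t) Rinv.

End RMatrix.

(* The explicit form of the quantum duality principle: x is a lift of the basis
   of g with epsilon (x_i) = 0 describing H' and (H (x) H)' = H' (x) H'. *)
Record is_duality_lift (x : 'I_d -> hvec k B) : Prop := IsDualityLift {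
  lift_modh : forall i, modh (x i) = theta (iota << i >>);
  lift_counit : forall i, hcounit H (x i) = 0;
  lift_primed : forall a, primed H a <-> hseries H x a;
  lift_primed2 : forall t, primed H2 t <-> hseries2 H x t }.

(* p exhibits the k-algebra F as (H (x) H)' / h (H (x) H)', that is as
   F[[g^* (+) g^*]]; only the values of p on (H (x) H)' matter. *)
Record is_specialisation (F : comAlgType k) (p : hvec k (B * B) -> F) : Prop :=
  IsSpecialisation {
  spec_one : p (oneh H2) = 1;
  spec_closedM : forall s t, primed H2 s -> primed H2 t -> primed H2 (mulh H2 s t);
  spec_mul : forall s t, primed H2 s -> primed H2 t -> p (mulh H2 s t) = p s * p t;
  spec_add : forall s t, primed H2 s -> primed H2 t -> p (s + t) = p s + p t;
  spec_scale : forall (c : fps k) t, primed H2 t -> p (c *: t) = c 0%N *: p t;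
  spec_surj : forall f, exists2 t, primed H2 t & p t = f;
  spec_ker : forall t, primed H2 t ->
    p t = 0 <-> exists2 s, primed H2 s & t = hbar *: s }.

End Quantisation.

Section CotangentSpace.
Variables (k : fieldType) (F : comAlgType k).

Record is_ideal (m : F -> Prop) : Prop := IsIdeal {
  ideal0 : m 0;
  idealD : forall f f', m f -> m f' -> m (f + f');
  idealM : forall f f', m f' -> m (f * f') }.

Definition is_maximal_ideal (m : F -> Prop) : Prop :=
  [/\ is_ideal m, ~ m 1 &
      forall n : F -> Prop, is_ideal n -> ~ n 1 ->
        (forall f, m f -> n f) -> forall f, n f -> m f].

Definition ideal_square (m : F -> Prop) (f : F) : Prop :=
  exists n (u v : 'I_n -> F),
    (forall i, m (u i) /\ m (v i)) /\ f = \sum_(i < n) u i * v i.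

(* q exhibits the vector space V as m / m^2; only its values on m matter. *)
Record is_cotangent (m : F -> Prop) (V : lmodType k) (q : F -> V) : Prop :=
  IsCotangent {
  cot_linear : forall (c : k) f f', m f -> m f' -> q (c *: f + f') = c *: q f + q f';
  cot_surj : forall v, exists2 f, m f & q f = v;
  cot_ker : forall f, m f -> q f = 0 <-> ideal_square m f }.

End CotangentSpace.

(* Main.v *)
(* Write P = (H (x) H)', g_i for the elements h x_i (x) 1 and 1 (x) h x_i, and
   let aug be the image in F = P / hP of P /\ h(H (x) H).
   - Geometric series converge in P, so F is local with maximal ideal aug.
   - Peeling one generator off each monomial of degree at least 2 writes every
     element of P as a.1 + sum_i b_i g_i + sum_i g_i u_i, with a, b_i in k[[h]]
     and u_i in P /\ h(H (x) H).  If it lies in h^2 (H (x) H), then h divides a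
     and the b_i, because 1, x_1, ..., x_d are independent modulo h; hence its
     class in F is in aug^2.
   - R = 1 modulo h, so R t R^-1 - t is in h^2 (H (x) H) whenever t is in
     P /\ h(H (x) H). *)
Require Import Defs.
From mathcomp Require Import all_boot all_order all_algebra finmap monalg.
From mathcomp Require Import boolp.

Import GRing.Theory.
Local Open Scope fset_scope.
Local Open Scope ring_scope.

Set Implicit Arguments.
Unset Strict Implicit.
Unset Printing Implicit Defensive.

(** * Topologically free k[[h]]-modules *)

Section LinearMaps.
Variables (A : pzRingType) (V W : lmodType A) (F : V -> W).
Hypothesis Flin : linear F.

Lemma linearP_add : {morph F : u v / u + v}.
Proof. by move=> u v; rewrite -[u]scale1r Flin !scale1r. Qed.

Lemma linearP_zero : F 0 = 0.
Proof. by apply: (addIr (F 0)); rewrite -linearP_add !add0r. Qed.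

Lemma linearP_scale a u : F (a *: u) = a *: F u.
Proof. by rewrite -[a *: u]addr0 Flin linearP_zero addr0. Qed.

Lemma linearP_opp : {morph F : u / - u}.
Proof. by move=> u; rewrite -scaleN1r linearP_scale scaleN1r. Qed.

Lemma linearP_sub : {morph F : u v / u - v}.
Proof. by move=> u v; rewrite linearP_add linearP_opp. Qed.

Lemma linearP_sum I (s : seq I) (P : pred I) (u : I -> V) :
  F (\sum_(i <- s | P i) u i) = \sum_(i <- s | P i) F (u i).
Proof. exact: (big_morph F linearP_add linearP_zero). Qed.

End LinearMaps.

Lemma linearP_comp (A : pzRingType) (V W X : lmodType A) (F : V -> W) (G : W -> X) :
  linear F -> linear G -> linear (fun v => G (F v)).
Proof. by move=> Fl Gl a u v; rewrite Fl Gl. Qed.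

Section PowerSeries.
Variable k : fieldType.
Implicit Types (a b : fps k).

Lemma fps_sumE I (s : seq I) (P : pred I) (a : I -> fps k) n :
  (\sum_(i <- s | P i) a i) n = \sum_(i <- s | P i) a i n.
Proof. exact: (big_morph (fun c : fps k => c n)). Qed.

Lemma fps_addE a b n : (a + b) n = a n + b n. Proof. by []. Qed.

Lemma fps_mulE a b n : (a * b) n = \sum_(i < n.+1) a i * b (n - i)%N.
Proof. by []. Qed.

Definition fps_const (c : k) : fps k := fun n => if n == 0%N then c else 0.

Lemma hbar_mulE a n : (hbar * a) n = if n is m.+1 then a m else 0.
Proof.
rewrite fps_mulE; case: n => [|n]; first by rewrite big_ord1 mul0r.
rewrite big_ord_recl mul0r add0r big_ord_recl /= mul1r big1 ?addr0 ?subn1 //.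
by move=> i _; rewrite /hbar /= mul0r.
Qed.

End PowerSeries.

Section FreeModules.
Variables (k : fieldType) (B : choiceType).
Implicit Types (a : fps k) (f g : hvec k B).

Definition hcoord x f : fps k := fun n => (f n)@_x.

Lemma hcoordP f g : (forall x, hcoord x f = hcoord x g) -> f = g.
Proof.
move=> fg; apply: hvecP => n; apply/malgP => x.
exact: (congr1 (fun a : fps k => a n) (fg x)).
Qed.

Lemma hcoordD x f g : hcoord x (f + g) = hcoord x f + hcoord x g.
Proof. by apply: fpsP => n; exact: mcoeffD. Qed.

Lemma hcoordZ x a f : hcoord x (a *: f) = a * hcoord x f.
Proof.
apply: fpsP => n; rewrite /hcoord [a *: f]/(hvec_scale _ _) /hvec_scale raddf_sum.
by apply: eq_bigr => i _; exact: mcoeffZ.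
Qed.

Lemma hvecDE f g n : (f + g) n = f n + g n. Proof. by []. Qed.
Lemma hvecNE f n : (- f) n = - f n. Proof. by []. Qed.
Lemma hvec_sumE I (s : seq I) (P : pred I) (f : I -> hvec k B) n :
  (\sum_(i <- s | P i) f i) n = \sum_(i <- s | P i) f i n.
Proof. exact: (big_morph (fun c : hvec k B => c n)). Qed.

Lemma hvecZE a f n : (a *: f) n = \sum_(i < n.+1) a i *: f (n - i)%N.
Proof. by []. Qed.

Lemma hvecZ0E a f : (a *: f) 0%N = a 0%N *: f 0%N.
Proof. by rewrite hvecZE big_ord1. Qed.

Lemma hvec_constE c f n : (fps_const c *: f) n = c *: f n.
Proof.
rewrite hvecZE big_ord_recl subn0 big1 ?addr0 // => i _.
by rewrite /fps_const /= scale0r.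
Qed.

Lemma hbar_scaleE f n : (hbar *: f) n = if n is m.+1 then f m else 0.
Proof.
apply/malgP => x; rewrite -[LHS]/(hcoord x (hbar *: f) n) hcoordZ hbar_mulE.
by case: n => // ; rewrite mcoeff0.
Qed.

(** Multiplication by [hbar] shifts the coefficient sequence, so the quotient is obtained by
    dropping one vanishing coefficient at a time. *)
Lemma hdvdP n f : hdvd n f <-> (forall i, (i < n)%N -> f i = 0).
Proof.
split=> [[g ->]|].
  elim: n g => // n IH g [|i] lti; rewrite exprS -scalerA hbar_scaleE //.
  exact: IH.
elim: n f => [|n IH] f f0; first by exists f; rewrite expr0 scale1r.
have [|g Eg] := IH (fun i => f i.+1); first by move=> i lti; exact: f0.
exists g; rewrite exprS -scalerA -Eg; apply: hvecP => -[|i].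
  by rewrite hbar_scaleE f0.
by rewrite hbar_scaleE.
Qed.

Lemma hdvd_eq0 f : (forall n, hdvd n f) -> f = 0.
Proof. by move=> f0; apply: hvecP => n; have /hdvdP -> := f0 n.+1. Qed.

Lemma hdvdD n f g : hdvd n f -> hdvd n g -> hdvd n (f + g).
Proof.
by move=> /hdvdP f0 /hdvdP g0; apply/hdvdP => i lti; rewrite hvecDE f0 ?g0 ?addr0.
Qed.

Lemma hdvdZ n a f : hdvd n f -> hdvd n (a *: f).
Proof. by case=> g ->; exists (a *: g); rewrite !scalerA mulrC. Qed.

Lemma hdvdN n f : hdvd n f -> hdvd n (- f).
Proof. by rewrite -scaleN1r; exact: hdvdZ. Qed.

Lemma hdvdB n f g : hdvd n f -> hdvd n g -> hdvd n (f - g).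
Proof. by move=> f0 g0; apply: hdvdD => //; exact: hdvdN. Qed.

Lemma hdvd_zero n : hdvd n (0 : hvec k B).
Proof. by apply/hdvdP. Qed.

Lemma hdvd_sum n I (s : seq I) (P : pred I) (f : I -> hvec k B) :
  (forall i, P i -> hdvd n (f i)) -> hdvd n (\sum_(i <- s | P i) f i).
Proof. by move=> fP; elim/big_ind: _ => //; [exact: hdvd_zero | exact: hdvdD]. Qed.

Lemma hdvd0 f : hdvd 0 f.
Proof. by apply/hdvdP. Qed.

Lemma hdvd_le n n' f : (n <= n')%N -> hdvd n' f -> hdvd n f.
Proof.
by move=> le /hdvdP f0; apply/hdvdP => i lti; apply: f0; exact: leq_trans le.
Qed.

Lemma hdvd_hbar n f : hdvd n (hbar ^+ n *: f).
Proof. by exists f. Qed.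

(** This is h-adic completeness: only the terms of index at most m contribute to the coefficient of
    h^m, so each coefficient of the limit is a finite sum. *)
Lemma hvec_sum_series (v : nat -> hvec k B) : (forall n, hdvd n (v n)) ->
  exists V, forall N, hdvd N (V - \sum_(n < N) v n).
Proof.
move=> vP; exists (fun m => \sum_(n < m.+1) v n m) => N.
apply/hdvdP => m lt_mN; rewrite hvecDE hvecNE hvec_sumE.
(* The partial sum up to N has extra terms of index above m; these vanish at order m. *)
rewrite (big_ord_widen_cond _ xpredT (fun n => v n m) lt_mN) /=.
rewrite [X in _ - X](bigID (fun i : 'I_N => i < m.+1)%N) /=.
rewrite [X in _ - (_ + X)]big1 ?addr0 ?subrr //= => i.
by rewrite -leqNgt => le; have /hdvdP -> := vP i.
Qed.

Definition hconst (u : {malg k[B]}) : hvec k B := fun n => if n == 0%N then u else 0.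

Definition hshift f : hvec k B := fun n => f n.+1.

Lemma hvec_split f : f = hconst (f 0%N) + hbar *: hshift f.
Proof.
by apply: hvecP => -[|n]; rewrite hvecDE hbar_scaleE /= ?addr0 ?add0r.
Qed.

Lemma hconstE u : hconst u = \sum_(b <- msupp u) fps_const u@_b *: hbasis k b.
Proof.
apply: hvecP => n; rewrite hvec_sumE; case: n => [|n]; last first.
  by rewrite big1 // => b _; rewrite hvec_constE scaler0.
rewrite [LHS]monalgE; apply: eq_bigr => b _; rewrite hvec_constE.
by apply/malgP => x; rewrite mcoeffZ !mcoeffU mulr_natr.
Qed.

End FreeModules.

(* A k[[h]]-linear map sends h^n V[[h]] to h^n W[[h]], hence is h-adically
   continuous and determined by its values on the basis. *)
Lemma hlinear_eq (k : fieldType) (B C : choiceType) (F G : hvec k B -> hvec k C) :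
  linear F -> linear G -> (forall b, F (hbasis k b) = G (hbasis k b)) -> F =1 G.
Proof.
move=> Fl Gl FG f; apply: subr0_eq; apply: hdvd_eq0 => n; elim: n f => [|n IH] f.
  exact: hdvd0.
rewrite [f]hvec_split !(linearP_add Fl, linearP_add Gl) hconstE.
rewrite !(linearP_sum Fl, linearP_sum Gl) !(linearP_scale Fl, linearP_scale Gl).
rewrite (eq_bigr (fun b => G (fps_const (f 0)@_b *: hbasis k b))); last first.
  by move=> b _; rewrite (linearP_scale Fl) (linearP_scale Gl) FG.
rewrite opprD addrACA subrr add0r -scalerBr.
by have [g ->] := IH (hshift f); rewrite scalerA -exprS; exact: hdvd_hbar.
Qed.

(** * Linear extension from a basis *)

Section LinearExtension.
Variables (k : fieldType) (B C : choiceType).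
Variable (phi : B -> hvec k C).

(** The sums defining [hext] range over supports that depend on f. A fixed finite range makes the
    coordinate a sum of products of power series, where linearity is visible. A finite set can cover
    the supports only up to a given order, hence the bound n. *)
Lemma hcoord_hext (s : {fset B}) y f n :
    (forall i, (i <= n)%N -> msupp (f i) `<=` s) ->
  hcoord y (hext phi f) n = (\sum_(b <- s) hcoord b f * hcoord y (phi b)) n.
Proof.
move=> sP; rewrite /hcoord /hext fps_sumE raddf_sum /=.
under [RHS]eq_bigr do rewrite fps_mulE.
rewrite exchange_big /=; apply: eq_bigr => i _.
rewrite (big_fset_incl _ (sP i _)) -1?ltnS //=; first last.
  by move=> b _ /mcoeff_outdom ->; rewrite scale0r.
by rewrite raddf_sum /=; apply: eq_bigr => b _; rewrite mcoeffZ.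
Qed.

Lemma hext_linear : linear (hext phi).
Proof.
move=> a f g; apply: hcoordP => y; rewrite hcoordD hcoordZ; apply: fpsP => n.
(* One finite range serving f, g and a f + g up to order n. *)
pose s := (\bigcup_(i <- enum 'I_n.+1)
  (msupp (f i) `|` msupp (g i) `|` msupp ((a *: f + g)%R i)))%fset.
have sP i : (i <= n)%N -> msupp (f i) `|` msupp (g i) `|` msupp ((a *: f + g) i) `<=` s.
  rewrite -ltnS => lti.
  have hj : Ordinal lti \in enum 'I_n.+1 by rewrite mem_enum.
  exact: (@bigfcup_sup _ _ _ _ xpredT (fun j : 'I_n.+1 =>
    msupp (f j) `|` msupp (g j) `|` msupp ((a *: f + g)%R j))%fset hj isT).
have sf i : (i <= n)%N -> msupp (f i) `<=` s.
  by move=> /sP; apply: fsubset_trans; rewrite -fsetUA fsubsetUl.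
have sg i : (i <= n)%N -> msupp (g i) `<=` s.
  by move=> /sP; apply: fsubset_trans; rewrite (fsetUC (msupp (f i))) -fsetUA fsubsetUl.
have sa i : (i <= n)%N -> msupp ((a *: f + g) i) `<=` s.
  by move=> /sP; apply: fsubset_trans; rewrite fsubsetUr.
rewrite (hcoord_hext _ sa).
rewrite [RHS]fps_addE (hcoord_hext _ sg).
have -> : (a * hcoord y (hext phi f)) n =
    (a * (\sum_(b <- s) hcoord b f * hcoord y (phi b))) n.
  rewrite !fps_mulE; apply: eq_bigr => i _; congr (_ * _).
  apply: hcoord_hext => j lej; apply: sf; exact: leq_trans lej (leq_subr _ _).
rewrite mulr_sumr -fps_addE -big_split /= !fps_sumE.
by apply: eq_bigr => b _; rewrite hcoordD hcoordZ mulrDl mulrA.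
Qed.

Lemma hext_basis b : hext phi (hbasis k b) = phi b.
Proof.
apply: hcoordP => y; apply: fpsP => n.
rewrite (@hcoord_hext [fset b]) => [|[|i] _]; last by rewrite msupp0 fsub0set.
  rewrite big_seq_fset1 (_ : hcoord b _ = 1) ?mul1r //.
  by apply: fpsP => -[|m]; rewrite /hcoord /hbasis /= ?mcoeffUU ?mcoeff0.
exact: msuppU_le.
Qed.

End LinearExtension.

(** * Tensor products of vectors and of linear maps *)

Section TensorProducts.
Variable k : fieldType.

Lemma relab_linear (B C : choiceType) (s : B -> C) : linear (@relab k B C s).
Proof. exact: hext_linear. Qed.

Lemma relab_basis (B C : choiceType) (s : B -> C) b :
  relab s (hbasis k b) = hbasis k (s b).
Proof. exact: hext_basis. Qed.

Lemma kten_coeff (B C : choiceType) (u : {malg k[B]}) (v : {malg k[C]}) x y :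
  (kten u v)@_(x, y) = u@_x * v@_y.
Proof.
have coeffE (D : choiceType) (w : {malg k[D]}) z :
    w@_z = \sum_(e <- msupp w) w@_e *+ (e == z).
  by rewrite {1}(monalgE w) raddf_sum /=; apply: eq_bigr => e _; rewrite mcoeffU.
rewrite (coeffE _ u x) (coeffE _ v y) big_distrlr /kten raddf_sum /=.
apply: eq_bigr => b _; rewrite raddf_sum /=; apply: eq_bigr => c _.
by rewrite mcoeffU xpair_eqE mulrnAl mulrnAr -mulrnA mulnb andbC.
Qed.

Variables (B C : choiceType).
Implicit Types (f : hvec k B) (g : hvec k C).

Lemma hcoord_hten x y f g : hcoord (x, y) (hten f g) = hcoord x f * hcoord y g.
Proof.
apply: fpsP => n; rewrite /hcoord /hten raddf_sum.
by apply: eq_bigr => i _; exact: kten_coeff.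
Qed.

Lemma hten_linearl g : linear (fun f => hten f g).
Proof.
by move=> a f f'; apply: hcoordP => -[x y]; rewrite !(hcoord_hten, hcoordD, hcoordZ) mulrDl mulrA.
Qed.

Lemma hten_linearr f : linear (@hten k B C f).
Proof.
by move=> a g g'; apply: hcoordP => -[x y]; rewrite !(hcoord_hten, hcoordD, hcoordZ) mulrDr mulrCA.
Qed.

Lemma hten_basis (b : B) (c : C) : hten (hbasis k b) (hbasis k c) = hbasis k (b, c).
Proof.
apply: hvecP => -[|n]; apply/malgP => -[x y]; rewrite /hten raddf_sum big_ord_recl /=.
  by rewrite big_ord0 addr0 kten_coeff !mcoeffU xpair_eqE -natrM mulnb.
rewrite big1 => [|i _]; rewrite kten_coeff /hbasis /= mcoeff0 ?mul0r //.
by rewrite mulr0 addr0 mcoeff0.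
Qed.

Lemma modh_hten f g : modh (hten f g) = kten (modh f) (modh g).
Proof. by rewrite /modh /hten big_ord1. Qed.

End TensorProducts.

Section TensorMaps.
Variables (k : fieldType) (B C B' C' : choiceType).
Variables (F : hvec k B -> hvec k B') (G : hvec k C -> hvec k C').

Lemma tmap_linear : linear (tmap F G).
Proof. exact: hext_linear. Qed.

Hypotheses (Fl : linear F) (Gl : linear G).

(** [tmap] reads F and G on basis elements only; linearity in each argument reduces the identity to
    that case. *)
Lemma tmap_hten f g : tmap F G (hten f g) = hten (F f) (G g).
Proof.
move: f; apply: hlinear_eq => [||b].
- exact: linearP_comp (hten_linearl g) tmap_linear.
- exact: linearP_comp Fl (hten_linearl _).
move: g; apply: hlinear_eq => [||c].
- exact: linearP_comp (hten_linearr _) tmap_linear.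
- exact: linearP_comp Gl (hten_linearr _).
by rewrite hten_basis [LHS]hext_basis.
Qed.

End TensorMaps.

Lemma relab_assocl (k : fieldType) (B C D : choiceType)
    (f : hvec k B) (g : hvec k C) (h : hvec k D) :
  relab (@assocl B C D) (hten (hten f g) h) = hten f (hten g h).
Proof.
move: f; apply: hlinear_eq => [a f f'|a f f'|b].
- by rewrite !hten_linearl relab_linear.
- by rewrite hten_linearl.
move: g; apply: hlinear_eq => [a g g'|a g g'|c].
- by rewrite hten_linearr hten_linearl relab_linear.
- by rewrite hten_linearl hten_linearr.
move: h; apply: hlinear_eq => [a h h'|a h h'|e].
- by rewrite hten_linearr relab_linear.
- by rewrite !hten_linearr.
by rewrite !hten_basis relab_basis.
Qed.

Lemma relab_mid4 (k : fieldType) (A B C D : choiceType)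
    (f : hvec k A) (g : hvec k B) (h : hvec k C) (l : hvec k D) :
  relab (@mid4 A B C D) (hten (hten f g) (hten h l)) = hten (hten f h) (hten g l).
Proof.
move: f; apply: hlinear_eq => [a f f'|a f f'|b].
- by rewrite !hten_linearl relab_linear.
- by rewrite !hten_linearl.
move: g; apply: hlinear_eq => [a g g'|a g g'|c].
- by rewrite hten_linearr hten_linearl relab_linear.
- by rewrite hten_linearl hten_linearr.
move: h; apply: hlinear_eq => [a h h'|a h h'|e].
- by rewrite hten_linearl hten_linearr relab_linear.
- by rewrite hten_linearr hten_linearl.
move: l; apply: hlinear_eq => [a l l'|a l l'|e'].
- by rewrite !hten_linearr relab_linear.
- by rewrite !hten_linearr.
by rewrite !hten_basis relab_basis.
Qed.
(** * Multiplication, primed elements and monomials *)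

Lemma hlinear_hdvd (k : fieldType) (B C : choiceType) (F : hvec k B -> hvec k C) n f :
  linear F -> hdvd n f -> hdvd n (F f).
Proof. by move=> Fl [g ->]; rewrite (linearP_scale Fl); exact: hdvd_hbar. Qed.

Section Multiplication.
Variables (k : fieldType) (B : choiceType) (H : hopf_data k B).
Hypothesis mulHl : linear (hmul H).
Implicit Types a b c : hvec k B.

Lemma mulh_linearl b : linear (fun a => mulh H a b).
Proof. exact: linearP_comp (hten_linearl b) mulHl. Qed.

Lemma mulh_linearr a : linear (mulh H a).
Proof. exact: linearP_comp (hten_linearr a) mulHl. Qed.

Lemma hdvd_mulh m n a b : hdvd m a -> hdvd n b -> hdvd (m + n) (mulh H a b).
Proof.
case=> a' -> [b' ->]; rewrite (linearP_scale (mulh_linearr _)).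
by rewrite (linearP_scale (mulh_linearl _)) scalerA mulrC -exprD; exact: hdvd_hbar.
Qed.

End Multiplication.

Lemma mulhA (k : fieldType) (B : choiceType) (H : hopf_data k B) :
  is_hopf H -> associative (mulh H).
Proof.
move=> hH a b c; have ml := hmul_linear hH.
have := hmulA hH (hten (hten a b) c).
by rewrite relab_assocl !tmap_hten.
Qed.

(** * The tensor product of two Hopf algebras *)

Section TensorHopf.
Variables (k : fieldType) (B C : choiceType) (H : hopf_data k B) (K : hopf_data k C).
Local Notation HK := (tensor_hopf H K).

Lemma tensor_hmul_linear : linear (hmul HK).
Proof. exact: linearP_comp (relab_linear _) (tmap_linear _ _). Qed.

Lemma tensor_hcomul_linear : linear (hcomul HK).
Proof. exact: linearP_comp (tmap_linear _ _) (relab_linear _). Qed.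

Lemma tensor_hcounit_linear : linear (hcounit HK).
Proof. exact: linearP_comp (tmap_linear _ _) (relab_linear _). Qed.

Hypotheses (hH : is_hopf H) (hK : is_hopf K).

Lemma mulh_hten a b c e :
  mulh HK (hten a b) (hten c e) = hten (mulh H a c) (mulh K b e).
Proof.
have Hl := hmul_linear hH; have Kl := hmul_linear hK.
by rewrite /mulh /= relab_mid4 tmap_hten.
Qed.

Lemma oneh_hten : oneh HK = hten (oneh H) (oneh K).
Proof.
have Hl := hunit_linear hH; have Kl := hunit_linear hK.
by rewrite {1}/oneh /= relab_basis -hten_basis tmap_hten.
Qed.

Lemma tensor_mul1l t : mulh HK (oneh HK) t = t.
Proof.
move: t; apply: hlinear_eq => [||[b c]] //.
- exact: mulh_linearr tensor_hmul_linear _.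
- by rewrite oneh_hten -hten_basis mulh_hten (hmul1l hH) (hmul1l hK).
Qed.

Lemma tensor_mul1r t : mulh HK t (oneh HK) = t.
Proof.
move: t; apply: hlinear_eq => [||[b c]] //.
- exact: mulh_linearl tensor_hmul_linear _.
- by rewrite oneh_hten -hten_basis mulh_hten (hmul1r hH) (hmul1r hK).
Qed.

End TensorHopf.

(** * Primed elements form an h-adically closed submodule *)

Section Primed.
Variables (k : fieldType) (B : choiceType) (H : hopf_data k B).
Hypotheses (counitl : linear (hcounit H)) (comull : linear (hcomul H)).

Lemma deltan_linear n : linear (@deltan k B H n).
Proof.
have comulnl : linear (@hcomuln k B H n).
  by case: n => [|n] //; exact: linearP_comp comull (tmap_linear _ _).
have tmapnl (F : hvec k B -> hvec k B) : linear (@tmapn k B B F n).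
  by case: n {comulnl} => [|n] //; exact: tmap_linear.
exact: linearP_comp comulnl (tmapnl _).
Qed.

Lemma primed0 : primed H 0.
Proof.
by move=> n; rewrite (linearP_zero (@deltan_linear n)); exact: hdvd_zero.
Qed.

Lemma primedD s t : primed H s -> primed H t -> primed H (s + t).
Proof. by move=> sP tP n; rewrite (linearP_add (@deltan_linear n)); exact: hdvdD. Qed.

Lemma primedZ a t : primed H t -> primed H (a *: t).
Proof. by move=> tP n; rewrite (linearP_scale (@deltan_linear n)); exact: hdvdZ. Qed.

Lemma primedB s t : primed H s -> primed H t -> primed H (s - t).
Proof. by move=> sP tP; rewrite -scaleN1r; apply: primedD => //; exact: primedZ. Qed.

Lemma primed_sum I (r : seq I) (Q : pred I) (f : I -> hvec k B) :
  (forall i, Q i -> primed H (f i)) -> primed H (\sum_(i <- r | Q i) f i).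
Proof. by move=> fP; elim/big_ind: _ => //; [exact: primed0 | exact: primedD]. Qed.

(** The condition on [deltan n] depends on t modulo h^n only, since [deltan n] is k[[h]]-linear; a
    different approximant may serve for each n. *)
Lemma primed_closed t :
  (forall n, exists2 s, primed H s & hdvd n (t - s)) -> primed H t.
Proof.
move=> tP n; have [s sP ts] := tP n; rewrite -[t](subrK s).
rewrite (linearP_add (@deltan_linear n)); apply: hdvdD (sP n).
exact: hlinear_hdvd (@deltan_linear n) ts.
Qed.

End Primed.

(** * Ordered monomials and their factorisation *)

Section Monomials.
Variables (k : fieldType) (B : choiceType) (H : hopf_data k B) (hH : is_hopf H).
Variables (d : nat) (x : 'I_d -> hvec k B).
Implicit Types e f : {ffun 'I_d -> nat}.

Lemma deg_eq0 e : deg e = 0%N -> forall i, e i = 0%N.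
Proof. by move/eqP; rewrite /deg sum_nat_eq0 => /forallP e0 i; apply/eqP/e0. Qed.

Lemma monh_deg0 e : deg e = 0%N -> monh H x e = oneh H.
Proof.
move=> /deg_eq0 e0; rewrite /monh; elim/big_rec: _ => // i _ _ ->.
by rewrite e0 (hmul1l hH).
Qed.

(* The factor x i is the first one to occur in the ordered product. *)
Lemma monh_factor e : (0 < deg e)%N ->
  exists i e', [/\ (0 < e i)%N, deg e = (deg e').+1 &
    monh H x e = mulh H (x i) (monh H x e')].
Proof.
rewrite lt0n /deg sum_nat_eq0 negb_forall => /existsP[j].
rewrite negb_imply => /andP[_ ej].
(* Generalised to duplicate-free lists for the induction: without duplicates, lowering the exponent
   at the head leaves the factors of the tail unchanged. *)
suff main (r : seq 'I_d) : uniq r -> has (fun i => e i != 0%N) r ->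
    exists i e', [/\ e i = (e' i).+1, (forall l, l != i -> e' l = e l) &
      \big[mulh H/oneh H]_(l <- r) exph H (x l) (e l) =
      mulh H (x i) (\big[mulh H/oneh H]_(l <- r) exph H (x l) (e' l))].
  have [||i [e' [ei e'l E]]] := main (index_enum 'I_d).
  - exact: index_enum_uniq.
  - by apply/hasP; exists j => //; exact: mem_index_enum.
  exists i, e'; split=> //; first by rewrite ei.
  rewrite /deg (bigD1 i) //= ei [in RHS](bigD1 i) //= addSn.
  by congr (_ + _).+1; apply: eq_bigr => l /e'l.
elim: r => //= l r IH /andP[l_r r_uniq]; case: (posnP (e l)) => [el|el _].
  rewrite /= => /IH[//|i [e' [ei e'P E]]]; exists i, e'; split=> //.
  have li : l != i by apply/eqP => li; rewrite li ei in el.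
  by rewrite !big_cons e'P // el [exph _ _ 0]/(oneh H) (hmul1l hH _) E (hmul1l hH _).
pose e' := [ffun i => if i == l then (e l).-1 else e i].
exists l, e'; split.
- by rewrite ffunE eqxx prednK.
- by move=> i /negbTE il; rewrite ffunE il.
have -> : \big[mulh H/oneh H]_(i <- l :: r) exph H (x i) (e' i) =
    mulh H (exph H (x l) (e l).-1) (\big[mulh H/oneh H]_(i <- r) exph H (x i) (e i)).
  rewrite big_cons ffunE eqxx; congr (mulh H _ _).
  apply: eq_big_seq => i ir; rewrite ffunE; case: eqP => // il.
  by rewrite il (negbTE l_r) in ir.
by rewrite big_cons (mulhA hH) -{1}(prednK el).
Qed.

Definition exp_zero : {ffun 'I_d -> nat} := [ffun _ => 0%N].
Definition exp_delta i : {ffun 'I_d -> nat} := [ffun j => nat_of_bool (j == i)].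

Lemma deg_zero : deg exp_zero = 0%N.
Proof. by rewrite /deg big1 // => i _; rewrite ffunE. Qed.

Lemma deg_delta i : deg (exp_delta i) = 1%N.
Proof.
by rewrite /deg (bigD1 i) //= ffunE eqxx big1 // => j /negbTE ji; rewrite ffunE ji.
Qed.

Lemma monh_delta i : monh H x (exp_delta i) = x i.
Proof.
have [|j [e' [+ + ->]]] := @monh_factor (exp_delta i).
  by rewrite deg_delta.
rewrite ffunE deg_delta; case: eqP => // -> _ [/esym/monh_deg0 ->].
exact: hmul1r.
Qed.

(** The scaled monomials whose convergent combinations make up [hseries2]. *)
Definition mono2 e f : hvec k (B * B) :=
  hbar ^+ (deg e + deg f) *: hten (monh H x e) (monh H x f).

Definition gen2 (i : 'I_d + 'I_d) : hvec k (B * B) :=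
  match i with
  | inl i => hten (hbar *: x i) (oneh H)
  | inr i => hten (oneh H) (hbar *: x i)
  end.

(** The generator is taken from the left tensor factor if e is nonzero, and from the right one
    otherwise. It is already leftmost in its factor and carries one power of h, so nothing has to be
    commuted. *)
Lemma mono2_factor e f n : (deg e + deg f = n.+1)%N ->
  exists i e' f', (deg e' + deg f' = n)%N /\
    mono2 e f = mulh (tensor_hopf H H) (gen2 i) (mono2 e' f').
Proof.
move=> def; have ml := tensor_hmul_linear H H.
case: (posnP (deg e)) => [e0|/monh_factor[i [e' [_ ee' E]]]].
  have /monh_factor[i [f' [_ ff' E]]] : (0 < deg f)%N by rewrite e0 add0n in def; rewrite def.
  exists (inr i), e, f'; split; first by move: def; rewrite ff' addnS => -[].
  rewrite /mono2 /gen2 (linearP_scale (mulh_linearr ml _)) (mulh_hten hH hH).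
  rewrite (hmul1l hH) (linearP_scale (mulh_linearl (hmul_linear hH) _)) E.
  by rewrite (linearP_scale (hten_linearr _)) scalerA ff' addnS exprSr.
exists (inl i), e', f; split; first by move: def; rewrite ee' addSn => -[].
rewrite /mono2 /gen2 (linearP_scale (mulh_linearr ml _)) (mulh_hten hH hH).
rewrite (hmul1l hH) (linearP_scale (mulh_linearl (hmul_linear hH) _)) E.
by rewrite (linearP_scale (hten_linearl _)) scalerA ee' addSn exprSr.
Qed.

Lemma mono2_deg0 e f : (deg e + deg f = 0)%N -> mono2 e f = oneh (tensor_hopf H H).
Proof.
move=> def; have /eqP := def; rewrite addn_eq0 => /andP[/eqP e0 /eqP f0].
by rewrite /mono2 def scale1r !monh_deg0 // (oneh_hten hH hH).
Qed.

Lemma hdvd_mono2 e f : hdvd (deg e + deg f) (mono2 e f).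
Proof. exact: hdvd_hbar. Qed.

End Monomials.

(** * Decomposition of the elements of (H (x) H)' *)

Section Decomposition.
Variables (k : fieldType) (B : choiceType) (H : hopf_data k B) (hH : is_hopf H).
Variables (d : nat) (x : 'I_d -> hvec k B).
Local Notation H2 := (tensor_hopf H H).
Hypothesis primed2P : forall t, primed H2 t <-> hseries2 H x t.
Implicit Types e f : {ffun 'I_d -> nat}.

Let ml := tensor_hmul_linear H H.
Let counitl := tensor_hcounit_linear H H.
Let comull := tensor_hcomul_linear H H.

Lemma expoK N e (e' : {ffun 'I_d -> 'I_N.+1}) :
  (expo e' == e) = [forall i, e i < N.+1]%N && (e' == [ffun i => inord (e i)]).
Proof.
apply/eqP/andP => [<-|[/forallP eN /eqP ->]].
  split; first by apply/forallP => i; rewrite ffunE.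
  by apply/eqP/ffunP => i; rewrite !ffunE inord_val.
by apply/ffunP => i; rewrite !ffunE inordK.
Qed.

(** This makes the monomials outside a box of exponents h-adically small. *)
Lemma deg_ge N e : ~~ [forall i, e i < N]%N -> (N <= deg e)%N.
Proof.
rewrite negb_forall => /existsP[i]; rewrite -leqNgt => /leq_trans; apply.
by rewrite /deg (bigD1 i) //= leq_addr.
Qed.

Lemma primed_mono2 e f : primed H2 (mono2 H x e f).
Proof.
apply/primed2P.
(* The coefficients are a Kronecker delta. The case N = 0 is set aside because [inord] needs a
   nonempty box. *)
exists (fun e' f' => ((e' == e) && (f' == f))%:R) => -[|N]; first exact: hdvd0.
rewrite pair_big /=.
have [/andP[eN fN]|eN] := boolP ([forall i, e i < N.+1]%N && [forall i, f i < N.+1]%N).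
  rewrite (bigD1 ([ffun i => inord (e i)], [ffun i => inord (f i)])) //= big1 => [|[e' f'] /=].
    have E (g : {ffun 'I_d -> nat}) : [forall i, g i < N.+1]%N ->
        expo [ffun i => inord (g i) : 'I_N.+1] = g.
      by move=> gN; apply/eqP; rewrite expoK gN eqxx.
    by rewrite !E // !eqxx mul1r addr0 subrr; exact: hdvd_zero.
  rewrite xpair_eqE !expoK eN fN /= => /negbTE ->.
  by rewrite mul0r scale0r.
(* When (e, f) lies outside the box the truncated sum is zero, and the monomial itself is divisible
   by h^N. *)
rewrite big1 => [|[e' f'] _ /=].
  rewrite subr0; apply: hdvd_le (hdvd_mono2 _ _ e f).
  by move: eN; rewrite negb_and => /orP[]/deg_ge le;
  apply: leq_trans le _; rewrite ?leq_addr ?leq_addl.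
move: eN; rewrite !expoK.
by case: [forall i, _]; case: [forall i, _]; rewrite //= ?andbF mul0r scale0r.
Qed.

Lemma primed_oneh2 : primed H2 (oneh H2).
Proof.
by rewrite -(@mono2_deg0 k B H hH d x _ _ (f_equal2 addn (deg_zero d) (deg_zero d)));
  exact: primed_mono2.
Qed.

Lemma primed_gen2 i : primed H2 (gen2 H x i).
Proof.
have E0 : monh H x (exp_zero d) = oneh H by apply: monh_deg0 (deg_zero d).
case: i => i.
- have := primed_mono2 (exp_delta i) (exp_zero d).
  by rewrite /mono2 monh_delta // E0 deg_delta deg_zero -(linearP_scale (hten_linearl _)).
- have := primed_mono2 (exp_zero d) (exp_delta i).
  by rewrite /mono2 monh_delta // E0 deg_delta deg_zero -(linearP_scale (hten_linearr _)).
Qed.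

(** Divisibility of the u i is meant in H (x) H, not in P: a scaled monomial divided by its power of
    h is in general no longer primed. *)
Definition in_ideal n t := exists2 u : 'I_d + 'I_d -> hvec k (B * B),
  (forall i, primed H2 (u i) /\ hdvd n (u i)) &
  t = \sum_i mulh H2 (gen2 H x i) (u i).

Lemma in_idealD n s t : in_ideal n s -> in_ideal n t -> in_ideal n (s + t).
Proof.
case=> u uP -> [v vP ->]; exists (fun i => u i + v i) => [i|].
  have [u1 u2] := uP i; have [v1 v2] := vP i.
  by split; [exact: primedD | exact: hdvdD].
by rewrite -big_split; apply: eq_bigr => i _; rewrite (linearP_add (mulh_linearr ml _)).
Qed.

Lemma in_idealZ n a t : in_ideal n t -> in_ideal n (a *: t).
Proof.
case=> u uP ->; exists (fun i => a *: u i) => [i|].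
  by have [u1 u2] := uP i; split; [exact: primedZ | exact: hdvdZ].
by rewrite scaler_sumr; apply: eq_bigr => i _; rewrite (linearP_scale (mulh_linearr ml _)).
Qed.

Lemma in_ideal0 n : in_ideal n 0.
Proof.
exists (fun=> 0) => [i|]; first by split; [exact: primed0 | exact: hdvd_zero].
by rewrite big1 // => i _; exact: linearP_zero (mulh_linearr ml _).
Qed.

Lemma in_ideal_gen n i w : primed H2 w -> hdvd n w ->
  in_ideal n (mulh H2 (gen2 H x i) w).
Proof.
move=> wP wn; exists (fun j => if j == i then w else 0) => [j|].
  by case: eqP => // _; split; [exact: primed0 | exact: hdvd_zero].
rewrite (bigD1 i) //= eqxx big1 ?addr0 // => j /negbTE ->.
exact: linearP_zero (mulh_linearr ml _).
Qed.

Lemma in_ideal_mono2 e f n : (n < deg e + deg f)%N -> in_ideal n (mono2 H x e f).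
Proof.
move=> lt; have E : (deg e + deg f = (deg e + deg f).-1.+1)%N by rewrite prednK // (leq_trans _ lt).
have [i [e' [f' [ee' ->]]]] := mono2_factor hH x E.
apply: in_ideal_gen; first exact: primed_mono2.
by apply: hdvd_le (hdvd_mono2 H x e' f'); rewrite ee' -ltnS -E.
Qed.

Lemma in_ideal_sum n I (r : seq I) (Q : pred I) (t : I -> hvec k (B * B)) :
  (forall i, Q i -> in_ideal n (t i)) -> in_ideal n (\sum_(i <- r | Q i) t i).
Proof. by move=> tP; elim/big_ind: _ => //; [exact: in_ideal0 | exact: in_idealD]. Qed.

(** A first-order Taylor expansion: the remainder is a sum of products of two primed elements that
    are both divisible by h in H (x) H. *)
Definition affine t := exists a b r, in_ideal 1 r /\
  t = a *: oneh H2 + \sum_i b i *: gen2 H x i + r.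

Lemma affineD s t : affine s -> affine t -> affine (s + t).
Proof.
case=> a [b [r [rP ->]]] [a' [b' [r' [rP' ->]]]].
exists (a + a'), (fun i => b i + b' i), (r + r'); split; first exact: in_idealD.
rewrite addrACA [X in X + _]addrACA -scalerDl -big_split; congr (_ + _ + _).
by apply: eq_bigr => i _; rewrite scalerDl.
Qed.

Lemma affineZ c t : affine t -> affine (c *: t).
Proof.
case=> a [b [r [rP ->]]]; exists (c * a), (fun i => c * b i), (c *: r).
split; first exact: in_idealZ.
by under [in RHS]eq_bigr do rewrite -scalerA; rewrite !scalerDr scalerA scaler_sumr.
Qed.

Lemma affine_ideal r : in_ideal 1 r -> affine r.
Proof.
move=> rP; exists 0, (fun=> 0), r; split=> //.
by rewrite scale0r big1 ?add0r // => i _; rewrite scale0r.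
Qed.

Lemma affine_sum I (r : seq I) (Q : pred I) (t : I -> hvec k (B * B)) :
  (forall i, Q i -> affine (t i)) -> affine (\sum_(i <- r | Q i) t i).
Proof.
move=> tP; elim/big_ind: _ => //; last exact: affineD.
exact/affine_ideal/in_ideal0.
Qed.

Lemma affine_mono2 e f : affine (mono2 H x e f).
Proof.
case E : (deg e + deg f)%N => [|[|n]]; last by apply/affine_ideal/in_ideal_mono2; rewrite E.
- exists 1, (fun=> 0), 0; split; first exact: in_ideal0.
  by rewrite (mono2_deg0 hH x E) scale1r addr0 big1 ?addr0 // => i _; rewrite scale0r.
- have [i [e' [f' [ee' ->]]]] := mono2_factor hH x E.
  exists 0, (fun j => (j == i)%:R), 0; split; first exact: in_ideal0.
  rewrite (mono2_deg0 hH x ee') (tensor_mul1r hH hH) scale0r add0r addr0.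
  by rewrite (bigD1 i) //= eqxx scale1r big1 ?addr0 // => j /negbTE ->; rewrite scale0r.
Qed.

Definition box_sum (c : {ffun 'I_d -> nat} -> {ffun 'I_d -> nat} -> fps k) N :=
  \sum_(p : {ffun 'I_d -> 'I_N} * {ffun 'I_d -> 'I_N})
     c (expo p.1) (expo p.2) *: mono2 H x (expo p.1) (expo p.2).

(** A term in the larger box but not in the smaller one has some exponent equal to N + 1. Its degree
    exceeds N, so peeling off a generator leaves a factor divisible by h^N. *)
Lemma box_sum_step c N : in_ideal N (box_sum c N.+2 - box_sum c N.+1).
Proof.
pose in_box (e : {ffun 'I_d -> 'I_N.+2}) := [forall i, expo e i < N.+1]%N.
pose up (e : {ffun 'I_d -> 'I_N.+1}) : {ffun 'I_d -> 'I_N.+2} :=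
  [ffun i => widen_ord (leqnSn _) (e i)].
pose down (e : {ffun 'I_d -> 'I_N.+2}) : {ffun 'I_d -> 'I_N.+1} :=
  [ffun i => inord (e i)].
have upK v : down (up v) = v by apply/ffunP => i; rewrite !ffunE inord_val.
have expo_up v : expo (up v) = expo v by apply/ffunP => i; rewrite !ffunE.
have downK v : in_box v -> up (down v) = v.
  by move/forallP => eN; apply/ffunP => i; apply: val_inj; rewrite !ffunE /= inordK //;
    have := eN i; rewrite ffunE.
(* The part inside the smaller box is reindexed along [up] and cancels. *)
rewrite [box_sum c N.+2](bigID (fun p => in_box p.1 && in_box p.2)) /=.
rewrite (reindex_onto (fun p => (up p.1, up p.2)) (fun p => (down p.1, down p.2))) /=; last first.
  by case=> e f /= /andP[eN fN]; rewrite !downK.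
rewrite (eq_bigl xpredT) => [|[e f]] /=; last first.
  rewrite !upK eqxx andbT; apply/andP; split; apply/forallP => i; rewrite expo_up ffunE //.
under eq_bigr do rewrite !expo_up.
rewrite addrAC subrr add0r; apply: in_ideal_sum => -[e f] /= efN.
apply: in_idealZ; apply: in_ideal_mono2.
by move: efN; rewrite negb_and => /orP[]/deg_ge le;
  apply: leq_trans le _; rewrite ?leq_addr ?leq_addl.
Qed.

(** The terms with exponents below 2 form a finite sum of affine elements. The rest is a telescoping
    series of elements of the ideal; as there are finitely many generators, the cofactors of each
    can be summed separately. *)
Lemma primed_affine t : primed H2 t -> affine t.
Proof.
move/primed2P => [c cP].
have tN N : hdvd N (t - box_sum c N).
  rewrite /box_sum; under eq_bigr do rewrite scalerA.
  by have := cP N; rewrite pair_big.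
(* Starting from the box of size 2 makes every cofactor, including the one with n = 0, divisible by
   h. *)
have /choice[u /all_and2[uP uE]] : forall n, exists u : 'I_d + 'I_d -> hvec k (B * B),
    (forall i, primed H2 (u i) /\ hdvd n.+1 (u i)) /\
    box_sum c n.+3 - box_sum c n.+2 = \sum_i mulh H2 (gen2 H x i) (u i).
  by move=> n; have [u uP uE] := box_sum_step c n.+1; exists u.
have /choice[V VP] : forall i, exists V, forall N, hdvd N (V - \sum_(n < N) u n i).
  move=> i; apply: (hvec_sum_series (v := fun n => u n i)) => n.
  by apply: hdvd_le (leqnSn n) _; have [] := uP n i.
rewrite -[t](subrK (box_sum c 2)) addrC; apply: affineD.
  by apply: affine_sum => p _; apply: affineZ; exact: affine_mono2.
apply: affine_ideal; exists V => [i|].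
  split.
    apply: primed_closed => // N; exists (\sum_(n < N) u n i) => //.
    by apply: primed_sum => // n _; have [] := uP n i.
  (* Modulo h, the limit is its first term, which h divides. *)
  rewrite -[V i](subrK (\sum_(n < 1) u n i)); apply: hdvdD => //.
  by rewrite big_ord1; have [] := uP 0%N i.
(* The identity is checked modulo every h^N, where the sum of cofactors may be truncated and
   telescopes. *)
apply: subr0_eq; apply: hdvd_eq0 => N.
have tele : \sum_i mulh H2 (gen2 H x i) (\sum_(n < N) u n i) =
    box_sum c N.+2 - box_sum c 2.
  under eq_bigr do rewrite (linearP_sum (mulh_linearr ml _)).
  rewrite exchange_big /=; under eq_bigr do rewrite -uE.
  by elim: N => [|N IH]; [rewrite big_ord0 subrr | rewrite big_ord_recr IH /= addrC subrKA].
rewrite -[t - _](subrKA (box_sum c N.+2)) -tele -addrA -sumrB; apply: hdvdD.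
  by apply: hdvd_le (tN N.+2); rewrite -addn2 leq_addr.
apply: hdvd_sum => i _; rewrite -(linearP_sub (mulh_linearr ml _)).
by apply: hlinear_hdvd (mulh_linearr ml _) _; rewrite -opprB; exact: hdvdN.
Qed.

End Decomposition.

(** * The local algebra F and the braiding *)

Lemma mcoeff_sum (k : fieldType) (B : choiceType) (z : B) I (r : seq I) (P : pred I)
    (u : I -> {malg k[B]}) :
  (\sum_(i <- r | P i) u i)@_z = \sum_(i <- r | P i) (u i)@_z.
Proof. exact: raddf_sum. Qed.

(** * Linear independence in a tensor square *)

Section Independence.
Variables (k : fieldType) (d : nat) (B : choiceType).
Variables (w0 : {malg k[B]}) (w : 'I_d -> {malg k[B]}).
Hypothesis w_free : forall a b, a *: w0 + \sum_i b i *: w i = 0 ->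
  a = 0 /\ (forall i, b i = 0).

Lemma free_neq0 : w0 != 0.
Proof.
apply/eqP => w00; have [] := w_free (a := 1) (b := fun=> 0).
  by rewrite w00 scaler0 add0r big1 // => i _; rewrite scale0r.
by move/eqP; rewrite oner_eq0.
Qed.

Lemma free_coeff : exists y, w0@_y != 0.
Proof.
apply: contrapT => w00; have := free_neq0; move/eqP; apply; apply/malgP => y.
by rewrite mcoeff0; apply/eqP; apply: contrapT => y0; apply: w00; exists y; apply/negP.
Qed.

(** Applying to one tensor factor a coordinate y at which w0 does not vanish leaves a relation
    between w0 and the w i in the other factor, whose coefficients on the w i are the wanted ones
    times the y-coordinate of w0. *)
Lemma kten_free a b c :
    a *: kten w0 w0 + \sum_i b i *: kten (w i) w0 + \sum_i c i *: kten w0 (w i) = 0 ->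
  (forall i, b i = 0) /\ (forall i, c i = 0).
Proof.
move=> E; have [y y0] := free_coeff.
have Eyz z z' : a * (w0@_z * w0@_z') + \sum_i b i * ((w i)@_z * w0@_z') +
    \sum_i c i * (w0@_z * (w i)@_z') = 0.
  rewrite -[RHS](@mcoeff0 (B * B)%type k (z, z')) -E.
  rewrite mcoeffD mcoeffD mcoeffZ kten_coeff.
  by congr (_ + _ + _); rewrite mcoeff_sum; apply: eq_bigr => i _; rewrite mcoeffZ kten_coeff.
split=> i; apply/eqP; rewrite -(mulIr_eq0 _ (mulIf y0)); apply/eqP.
- have [|_ ->//] := w_free (a := a * w0@_y + \sum_j c j * (w j)@_y) (b := fun j => b j * w0@_y).
  apply/malgP => z; rewrite mcoeff0 -[RHS](Eyz z y) mcoeffD mcoeffZ mcoeff_sum /= mulrDl addrAC.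
  congr (_ + _ + _).
  + by rewrite -mulrA (mulrC w0@_y).
  + by apply: eq_bigr => j _; rewrite mcoeffZ mulrAC mulrA.
  + by rewrite mulr_suml; apply: eq_bigr => j _; rewrite -mulrA (mulrC w0@_z).
- have [|_ ->//] := w_free (a := a * w0@_y + \sum_j b j * (w j)@_y) (b := fun j => c j * w0@_y).
  apply/malgP => z; rewrite mcoeff0 -[RHS](Eyz y z) mcoeffD mcoeffZ mcoeff_sum /= mulrDl.
  congr (_ + _ + _).
  + by rewrite -mulrA.
  + by rewrite mulr_suml; apply: eq_bigr => j _; rewrite -mulrA.
  + by apply: eq_bigr => j _; rewrite mcoeffZ mulrA.
Qed.

End Independence.

(** * The local algebra F and its augmentation ideal *)

Section Specialisation.
Variables (k : fieldType) (B : choiceType) (H : hopf_data k B) (hH : is_hopf H).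
Variables (d : nat) (x : 'I_d -> hvec k B).
Local Notation H2 := (tensor_hopf H H).
Hypothesis primed2P : forall t, primed H2 t <-> hseries2 H x t.
Hypothesis x_free : forall a b, a *: modh (oneh H) + \sum_i b i *: modh (x i) = 0 ->
  a = 0 /\ (forall i, b i = 0).
Variables (F : comAlgType k) (p : hvec k (B * B) -> F).
Hypothesis F_spec : is_specialisation H p.

Let ml := tensor_hmul_linear H H.
Let counitl := tensor_hcounit_linear H H.
Let comull := tensor_hcomul_linear H H.

Lemma oneh2_0 : (oneh H2) 0%N != 0.
Proof.
have [y y0] := free_coeff x_free.
rewrite (oneh_hten hH hH) -/(modh _) modh_hten; apply/eqP => E.
have := kten_coeff (modh (oneh H)) (modh (oneh H)) y y; rewrite E mcoeff0.
by move/esym/eqP; rewrite mulf_eq0 (negbTE y0).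
Qed.

Lemma hdvd_gen2 i : hdvd 1 (gen2 H x i).
Proof.
case: i => i; rewrite /gen2.
- by rewrite (linearP_scale (hten_linearl _)) -[hbar]expr1; exact: hdvd_hbar.
- by rewrite (linearP_scale (hten_linearr _)) -[hbar]expr1; exact: hdvd_hbar.
Qed.

Lemma gen2_inl_1 i : gen2 H x (inl i) 1%N = kten (modh (x i)) (modh (oneh H)).
Proof. by rewrite /gen2 (linearP_scale (hten_linearl _)) hbar_scaleE -modh_hten. Qed.

Lemma gen2_inr_1 i : gen2 H x (inr i) 1%N = kten (modh (oneh H)) (modh (x i)).
Proof. by rewrite /gen2 (linearP_scale (hten_linearr _)) hbar_scaleE -modh_hten. Qed.

(** The additional power of h comes from the generator. *)
Lemma primed_in_ideal n t : in_ideal H x n t -> primed H2 t /\ hdvd n.+1 t.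
Proof.
case=> u uP ->; split.
  apply: primed_sum => // i _; have [uiP _] := uP i.
  exact: spec_closedM F_spec _ _ (primed_gen2 hH primed2P i) uiP.
apply: hdvd_sum => i _; rewrite -add1n; have [_ ui] := uP i.
exact: (hdvd_mulh ml (hdvd_gen2 i) ui).
Qed.

Lemma spec_0 : p 0 = 0.
Proof.
have := spec_scale F_spec 0 (primed0 counitl comull).
by rewrite scaler0 => ->; rewrite scale0r.
Qed.

Lemma spec_sum I (r : seq I) (t : I -> hvec k (B * B)) :
  (forall i, primed H2 (t i)) -> p (\sum_(i <- r) t i) = \sum_(i <- r) p (t i).
Proof.
move=> tP; elim: r => [|i r IH]; first by rewrite !big_nil spec_0.
by rewrite !big_cons (spec_add F_spec) ?IH //; exact: primed_sum.
Qed.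

Lemma spec_ideal n u : (forall i, primed H2 (u i) /\ hdvd n (u i)) ->
  p (\sum_i mulh H2 (gen2 H x i) (u i)) = \sum_i p (gen2 H x i) * p (u i).
Proof.
move=> uP; have gP := primed_gen2 hH primed2P.
rewrite spec_sum => [|i]; last by apply: (spec_closedM F_spec) => //; have [] := uP i.
by apply: eq_bigr => i _; rewrite (spec_mul F_spec) //; have [] := uP i.
Qed.

(** In terms of formal functions, those vanishing at the origin. Here h divides t in H (x) H; an
    element of hP would be killed by p. *)
Definition augmentation f := exists2 t, primed H2 t /\ hdvd 1 t & p t = f.

Lemma ideal_augmentation : is_ideal augmentation.
Proof.
split.
- by exists 0; [split; [exact: primed0 | exact: hdvd_zero] | exact: spec_0].
- move=> f f' [s [sP s1] <-] [t [tP t1] <-]; exists (s + t).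
    by split; [exact: primedD | exact: hdvdD].
  exact: (spec_add F_spec).
- move=> f f' [t [tP t1] <-]; have [s sP <-] := spec_surj F_spec f.
  exists (mulh H2 s t); last exact: (spec_mul F_spec).
  split; first exact: (spec_closedM F_spec).
  exact: (hdvd_mulh ml (hdvd0 s) t1).
Qed.

(** If t represents 1, then 1 - t is in hP, so its constant coefficient vanishes; but when h divides
    t that coefficient is the one of the unit. *)
Lemma augmentation_proper : ~ augmentation 1.
Proof.
case=> t [tP /hdvdP t1] pt; have oneP := primed_oneh2 hH primed2P.
have /(spec_ker F_spec)[] : p (oneh H2 - t) = 0.
- rewrite -scaleN1r (spec_add F_spec) //; last exact: primedZ.
  by rewrite (spec_scale F_spec) // (spec_one F_spec) pt scaleN1r subrr.
- by apply: primedB.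
move=> s _ /(congr1 (fun f : hvec k (B * B) => f 0%N)).
by rewrite hbar_scaleE hvecDE hvecNE t1 // subr0; apply/eqP; exact: oneh2_0.
Qed.

(** The powers of u tend to 0 h-adically and their sum stays primed by closedness. A right inverse
    is enough, because its class is taken in the commutative algebra F. *)
Lemma geometric_series u : primed H2 u -> hdvd 1 u ->
  exists2 v, primed H2 v & mulh H2 (oneh H2 - u) v = oneh H2.
Proof.
move=> uP u1; have oneP := primed_oneh2 hH primed2P.
have powP n : primed H2 (exph H2 u n).
  by elim: n => [|n IH] //; exact: spec_closedM F_spec _ _ uP IH.
have pow_dvd n : hdvd n (exph H2 u n).
  elim: n => [|n IH]; [exact: hdvd0 | exact: (hdvd_mulh ml u1 IH)].
have [v vP] := hvec_sum_series pow_dvd; exists v.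
  apply: primed_closed => // N; exists (\sum_(n < N) exph H2 u n) => //.
  exact: primed_sum.
apply: subr0_eq; apply: hdvd_eq0 => N.
have tele : mulh H2 (oneh H2 - u) (\sum_(n < N) exph H2 u n) = oneh H2 - exph H2 u N.
  rewrite (linearP_sum (mulh_linearr ml _)).
  elim: N => [|N IH]; first by rewrite big_ord0 subrr.
  rewrite big_ord_recr IH (linearP_sub (mulh_linearl ml _)) (tensor_mul1l hH hH).
  exact: subrKA.
rewrite -[v](subrK (\sum_(n < N) exph H2 u n)) (linearP_add (mulh_linearr ml _)) tele.
rewrite -addrA addrAC subrr add0r; apply: hdvdB => //.
exact: hlinear_hdvd (mulh_linearr ml _) (vP N).
Qed.

(** Every element outside the augmentation ideal is invertible, so m is contained in that ideal, and
    maximality gives equality. *)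
Lemma maximal_ideal_augmentation m : is_maximal_ideal m ->
  forall f, m f <-> augmentation f.
Proof.
case=> [mI m1 mmax].
have m_aug f : m f -> augmentation f.
  have [t tP <-] := spec_surj F_spec f => mt; exists t => //; split=> //.
  have [a [b [r [rP Et]]]] := primed_affine hH primed2P tP.
  have t0 : t 0%N = a 0%N *: oneh H2 0%N.
    have [_ /hdvdP r0] := primed_in_ideal rP.
    rewrite Et !hvecDE hvec_sumE hvecZ0E big1 ?r0 ?addr0 // => i _.
    by have /hdvdP g0 := hdvd_gen2 i; rewrite hvecZ0E g0 // scaler0.
  have [a0|a0] := eqVneq (a 0%N) 0.
    by apply/hdvdP => -[|//] _; rewrite t0 a0 scale0r.
  (* Normalises the constant coefficient of t to that of the unit, so that c t is 1 minus a multiple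
     of h. *)
  pose c := fps_const (a 0%N)^-1; have cP : primed H2 (c *: t) by exact: primedZ.
  have [||v vP] := geometric_series (u := oneh H2 - c *: t).
  - by apply: primedB => //; exact: primed_oneh2.
  - apply/hdvdP => -[|//] _; rewrite hvecDE hvecNE hvec_constE t0 scalerA.
    by rewrite mulVf // scale1r subrr.
  rewrite subKr => /(congr1 p); rewrite (spec_mul F_spec) // (spec_one F_spec) => E.
  case: m1; rewrite -E mulrC; apply: (idealM mI).
  rewrite (spec_scale F_spec) // -[p t]mul1r scalerAl; exact: (idealM mI).
by move=> f; split=> [|/(mmax _ ideal_augmentation augmentation_proper m_aug)]; first exact: m_aug.
Qed.

Lemma spec_hdvd2 s : primed H2 s -> hdvd 2 s -> ideal_square augmentation (p s).
Proof.
move=> sP s2; have [a [b [r [rI Es]]]] := primed_affine hH primed2P sP.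
have [rP r2] := primed_in_ideal rI; have gP := primed_gen2 hH primed2P.
have oneP := primed_oneh2 hH primed2P.
(* The remainder r is divisible by h^2 as well, so the orders 0 and 1 of the affine part vanish. *)
have lin : hdvd 2 (a *: oneh H2 + \sum_i b i *: gen2 H x i).
  by rewrite -[X in hdvd 2 X](addrK r) -Es; exact: hdvdB.
have g0 i : gen2 H x i 0%N = 0 by have /hdvdP -> := hdvd_gen2 i.
have a0 : a 0%N = 0.
  have /hdvdP/(_ 0%N isT)/eqP := lin; rewrite hvecDE hvecZ0E hvec_sumE big1 => [|i _].
    by rewrite addr0 scaler_eq0 (negbTE oneh2_0) orbF => /eqP.
  by rewrite hvecZ0E g0 scaler0.
have hvecZ1E (e : fps k) (f : hvec k (B * B)) : (e *: f) 1%N = e 0%N *: f 1%N + e 1%N *: f 0%N.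
  by rewrite hvecZE big_ord_recl big_ord1.
have b0 i : b i 0%N = 0.
  (* This is the coefficient of h in the affine part; the generators, divisible by h, contribute
     only the constant terms of the b i. *)
  have : a 1%N *: kten (modh (oneh H)) (modh (oneh H)) +
      \sum_i b (inl i) 0%N *: kten (modh (x i)) (modh (oneh H)) +
      \sum_i b (inr i) 0%N *: kten (modh (oneh H)) (modh (x i)) = 0.
    rewrite -[RHS](iffLR (hdvdP _ _) lin 1%N isT) hvecDE hvecZ1E a0 scale0r add0r.
    rewrite (oneh_hten hH hH) -/(modh _) modh_hten hvec_sumE big_sumType addrA.
    congr (_ + _ + _); apply: eq_bigr => j _; rewrite hvecZ1E g0 scaler0 addr0.
      by rewrite gen2_inl_1.
    by rewrite gen2_inr_1.
  by move/(kten_free x_free) => [bl br]; case: i.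
have [u uP Er] := rI.
(* Scalars act on F through their value at h = 0, so the affine part maps to 0. *)
have ps : p s = \sum_i p (gen2 H x i) * p (u i).
  rewrite Es (spec_add F_spec) //; last first.
    by apply: primedD => //; [exact: primedZ | apply: primed_sum => // i _; exact: primedZ].
  rewrite Er (spec_ideal uP) (spec_add F_spec); last first.
  - by apply: primed_sum => // i _; exact: primedZ.
  - exact: primedZ.
  rewrite (spec_scale F_spec) // a0 scale0r add0r spec_sum => [|i]; last exact: primedZ.
  by rewrite big1 ?add0r // => i _; rewrite (spec_scale F_spec) // b0 scale0r.
exists #|{: 'I_d + 'I_d}|, (fun i => p (gen2 H x (enum_val i))), (fun i => p (u (enum_val i))).
split=> [i|]; first split.
- by exists (gen2 H x (enum_val i)) => //; split=> //; exact: hdvd_gen2.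
- by exists (u (enum_val i)).
- by rewrite ps (reindex _ (onW_bij _ (enum_val_bij _))).
Qed.

End Specialisation.

(** R t R^-1 - t equals (R - 1) t R^-1 + t (R^-1 - 1), and h divides both R - 1 and R^-1 - 1. *)
Lemma hdvd_AdR_sub (k : fieldType) (B : choiceType) (H : hopf_data k B)
    (R Rinv : hvec k (B * B)) n t :
  is_hopf H -> mulh (tensor_hopf H H) Rinv R = oneh (tensor_hopf H H) ->
  hdvd 1 (R - oneh (tensor_hopf H H)) -> hdvd n t -> hdvd n.+1 (AdR H R Rinv t - t).
Proof.
move=> hH RinvR R1 tn; have ml := tensor_hmul_linear H H.
set H2 := tensor_hopf H H in RinvR R1 ml *.
have Rinv1 : hdvd 1 (Rinv - oneh H2).
  (* R^-1 inherits its congruence to 1 from R. *)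
  have -> : Rinv - oneh H2 = - mulh H2 Rinv (R - oneh H2).
    rewrite (linearP_sub (mulh_linearr ml _)) RinvR opprB.
    by congr (_ - _); rewrite (tensor_mul1r hH hH).
  apply: hdvdN; exact: (hdvd_mulh ml (hdvd0 Rinv) R1).
have -> : AdR H R Rinv t - t =
    mulh H2 (mulh H2 (R - oneh H2) t) Rinv + mulh H2 t (Rinv - oneh H2).
  rewrite (linearP_sub (mulh_linearl ml _)) (tensor_mul1l hH hH).
  rewrite (linearP_sub (mulh_linearl ml _)) (linearP_sub (mulh_linearr ml _)).
  by rewrite (tensor_mul1r hH hH) subrKA.
apply: hdvdD.
- rewrite -[n.+1]addn0; apply: (hdvd_mulh ml) (hdvd0 _).
  by rewrite -add1n; exact: (hdvd_mulh ml).
- by rewrite -addn1; exact: (hdvd_mulh ml).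
Qed.

(** The relation is transported to U(g), where it reads a + y = 0 with y in g. The counit kills g
    and maps 1 to 1, so a = 0; injectivity of [iota] then gives y = 0. *)
Lemma lift_free (k : fieldType) (d : nat)
    (br : {malg k['I_d]} -> {malg k['I_d]} -> {malg k['I_d]})
    (delta : {malg k['I_d]} -> {malg k[('I_d * 'I_d)%type]})
    (U : algType k) (iota : {malg k['I_d]} -> U) (B : choiceType) (H : hopf_data k B)
    (theta : U -> {malg k[B]}) (x : 'I_d -> hvec k B) a b :
  is_enveloping br iota -> is_quantisation delta H iota theta ->
  (forall i, modh (x i) = theta (iota << i >>)) ->
  a *: modh (oneh H) + \sum_i b i *: modh (x i) = 0 -> a = 0 /\ (forall i, b i = 0).
Proof.
move=> env quant xE; have hH := quant_hopf quant.
have thl := quant_linear quant; have iol := env_linear env.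
pose y := \sum_i b i *: (<< i >> : {malg k['I_d]}).
rewrite (quant_one quant) -(linearP_scale thl).
have -> : \sum_i b i *: modh (x i) = theta (iota y).
  rewrite (linearP_sum iol) (linearP_sum thl); apply: eq_bigr => i _.
  by rewrite (linearP_scale iol) (linearP_scale thl) xE.
rewrite -(linearP_add thl) -(linearP_zero thl) => /(bij_inj (quant_bij quant)) E.
have a0 : a = 0.
  (* The multiple a of the unit reduces to an element of g, so its counit vanishes modulo h; that
     counit is also a. *)
  have /(quant_counit quant) : modh (fps_const a *: oneh H) = theta (iota (- y)).
    rewrite /modh hvec_constE -/(modh _) (quant_one quant) -(linearP_scale thl).
    by congr theta; rewrite (linearP_opp iol); apply/eqP; rewrite -addr_eq0 E.
  rewrite (linearP_scale (hcounit_linear hH)) (hcounit1 hH) /modh hvec_constE.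
  by move/(congr1 (mcoeff tt)); rewrite mcoeffZ mcoeffUU mulr1 mcoeff0.
split=> // i; move: E; rewrite a0 scale0r add0r -(linearP_zero iol).
move/(env_inj env)/(congr1 (mcoeff i)); rewrite mcoeff0 /y mcoeff_sum => <-.
rewrite (bigD1 i) //= big1 => [|j /negbTE ji].
  by rewrite addr0 (mcoeffZ (b i)) mcoeffUU mulr1.
by rewrite (mcoeffZ (b j)) mcoeffU ji mulr0.
Qed.

Theorem theorem2p5
  (k : fieldType) (k_char0 : [pchar k] =i pred0)
  (* the quasitriangular Lie bialgebra (g, r) *)
  (d : nat)
  (br : {malg k['I_d]} -> {malg k['I_d]} -> {malg k['I_d]})
  (delta : {malg k['I_d]} -> {malg k[('I_d * 'I_d)%type]})
  (r : {malg k[('I_d * 'I_d)%type]})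
  (g_qt : is_quasitriangular_lie br delta r)
  (* its enveloping algebra *)
  (U : algType k) (iota : {malg k['I_d]} -> U)
  (U_env : is_enveloping br iota)
  (* the quasitriangular QUEA (H, R) quantising (g, r) *)
  (B : choiceType) (H : hopf_data k B) (theta : U -> {malg k[B]})
  (H_quant : is_quantisation delta H iota theta)
  (R Rinv : hvec k (B * B))
  (H_rmat : is_rmatrix r H iota theta R Rinv)
  (* known fact: quantum duality principle *)
  (x : 'I_d -> hvec k B)
  (H_dual : is_duality_lift H iota theta x)
  (* known fact: Ad(R) restricts to an automorphism of (H (x) H)' *)
  (AdR_stable : forall t : hvec k (B * B),
     primed (tensor_hopf H H) (AdR H R Rinv t) <-> primed (tensor_hopf H H) t)
  (* F = (H (x) H)' / h (H (x) H)' = F[[g^* (+) g^*]] *)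
  (F : comAlgType k) (p : hvec k (B * B) -> F)
  (F_spec : is_specialisation H p)
  (* the braiding *)
  (RR : {lrmorphism F -> F})
  (RR_spec : forall t : hvec k (B * B), primed (tensor_hopf H H) t ->
     RR (p t) = p (AdR H R Rinv t))
  (* the maximal ideal, and any identification q of m / m^2 with g (+) g, such as
     the canonical one, class of h x~ |-> x *)
  (m : F -> Prop) (m_max : is_maximal_ideal m)
  (q : F -> ({malg k['I_d]} * {malg k['I_d]})%type)
  (q_cot : is_cotangent m q)
  (* the infinitesimal braiding *)
  (RRbar : ({malg k['I_d]} * {malg k['I_d]})%type ->
           ({malg k['I_d]} * {malg k['I_d]})%type)
  (RRbar_spec : forall f : F, m f -> RRbar (q f) = q (RR f)) :
  RRbar =1 id.
Proof.
have hH := quant_hopf H_quant.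
have [xE _ _ primed2P] := H_dual.
have x_free a b := lift_free (a := a) (b := b) U_env H_quant xE.
have [RinvR _ _ _ _ [rho ER _]] := H_rmat.
have augP := maximal_ideal_augmentation hH primed2P x_free F_spec m_max.
have counitl := tensor_hcounit_linear H H; have comull := tensor_hcomul_linear H H.
move=> v; have [f /[dup] mf /augP[t [tP t1] Ef] <-] := cot_surj q_cot v.
pose s := AdR H R Rinv t - t.
have sP : primed (tensor_hopf H H) s by apply: primedB => //; exact/AdR_stable.
have s2 : hdvd 2 s.
  apply: hdvd_AdR_sub => //; exists rho.
  by rewrite ER expr1 addrC addKr.
have [n [w [z [wz ps]]]] := spec_hdvd2 hH primed2P x_free F_spec sP s2.
(* The square of the augmentation ideal is rewritten as the square of m. *)
have ps_sq : ideal_square m (p s).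
  by exists n, w, z; split=> // i; have [/augP ? /augP ?] := wz i.
(* [cot_linear] and [cot_ker] speak of q on m only, so membership of p s in m is established
   first. *)
have mps : m (p s).
  have [mI _ _] := m_max; rewrite ps; elim/big_ind: _ => [||i _].
  - exact: ideal0 mI.
  - exact: idealD mI.
  - by apply: (idealM mI); have [_ /augP] := wz i.
(* The braiding moves f by the class of s, which q kills; the factor 1 matches the shape of
   [cot_linear]. *)
have RRf : RR f = 1 *: p s + f.
  by rewrite -Ef RR_spec // scale1r -(spec_add F_spec) // subrK.
rewrite RRbar_spec // RRf (cot_linear q_cot) // scale1r.
by rewrite (iffRL (cot_ker q_cot mps) ps_sq) add0r.
Qed.
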